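(* Let $R\neq 0$ be an effective ring. Then there exist a free $R[\mathbb Z\times\mathbb Z]$-module $M$ of finite rank and a fixed finite subset $F\subseteq M$ of non-zero elements such that the subset sum problem for $F$ is undecidable: there is no algorithm that, given $m\in M$, decides whether there exist pairwise distinct $g_1,\dots,g_n\in\mathbb Z\times\mathbb Z$ and (not necessarily distinct) $f_1,\dots,f_n\in F$ with $m=\sum_{i=1}^n g_if_i$.
   Context: An effective ring is a unital ring whose elements and arithmetic can be represented effectively (e.g. $\mathbb Z$ or $\mathbb Z/n\mathbb Z$). Elements of a free $R[\mathbb Z\times\mathbb Z]$-module of finite rank on a basis $X$ are identified with finitely supported functions $(\mathbb Z\times\mathbb Z)\times X\to R$, with action $(g_0f)(g,x)=f(g_0^{-1}g,x)$, and are given to the algorithm in this finite form. *)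

(* Defs.v *)
From HB Require Import structures.
From mathcomp Require Import all_boot all_order all_algebra.
Set Implicit Arguments. Unset Strict Implicit. Unset Printing Implicit Defensive.
Import Order.TTheory GRing.Theory Num.Theory.

(* Model of computation: register (Minsky) machines over nat.          *)
Inductive instr := INC of nat | DEC of nat & nat.

Definition prog := seq instr.
Definition mstate := (nat * (nat -> nat))%type.

Definition upd (f : nat -> nat) (r v : nat) : nat -> nat :=
  fun r' => if r' == r then v else f r'.

Definition step (p : prog) (s : mstate) : option mstate :=
  let: (pc, regs) := s in
  match nth None (map Some p) pc with
  | None => None
  | Some (INC r) => Some (pc.+1, upd regs r (regs r).+1)
  | Some (DEC r j) =>
      if regs r is n.+1 then Some (pc.+1, upd regs r n) else Some (j, regs)
  end.

Fixpoint exec (p : prog) (fuel : nat) (s : mstate) : option mstate :=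
  match fuel with
  | 0 => None
  | f.+1 => match step p s with None => Some s | Some s' => exec p f s' end
  end.

Definition init (x : nat) : mstate := (0, fun r => if r == 0 then x else 0).

Definition halts_with (p : prog) (x y : nat) : Prop :=
  exists fuel s, exec p fuel (init x) = Some s /\ s.2 0 = y.

Definition answers (p : prog) (x : nat) (P : Prop) : Prop :=
  (P /\ halts_with p x 1) \/ (~ P /\ halts_with p x 0).

(* Cantor pairing on nat *)
Definition npair (a b : nat) : nat := ((a + b) * (a + b).+1)./2 + b.

Definition effective (R : nzRingType) (code : R -> nat) : Prop :=
  injective code /\
  (exists p, forall n, answers p n (exists x, code x = n)) /\
  (exists p, forall x y : R, halts_with p (npair (code x) (code y)) (code (x + y)%R)) /\
  (exists p, forall x y : R, halts_with p (npair (code x) (code y)) (code (x * y)%R)) /\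
  (exists p, forall x : R, halts_with p (code x) (code (- x)%R)).

(* Free R[Z x Z]-modules of rank k with basis 'I_k.  An element is a   *)
(* finitely supported function (Z x Z) x 'I_k -> R, given in finite    *)
(* form as a list of entries (g, x, r) meaning r at (g, x) (entries    *)
(* with the same (g,x) are added up).                                  *)
Definition entry (R : nzRingType) (k : nat) := ((int * int) * 'I_k * R)%type.

Local Open Scope ring_scope.

Definition den (R : nzRingType) (k : nat) (s : seq (entry R k))
  : int * int -> 'I_k -> R :=
  fun g x => \sum_(e <- s | (e.1.1 == g) && (e.1.2 == x)) e.2.

(* action of g0 in Z x Z: (g0 f)(g, x) = f(g0^{-1} g, x) *)
Definition shift (R : nzRingType) (k : nat) (g0 : int * int)
  (f : int * int -> 'I_k -> R) : int * int -> 'I_k -> R :=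
  fun g x => f (g.1 - g0.1, g.2 - g0.2) x.

(* m is a subset sum of F: m = \sum_i g_i f_i with g_i pairwise distinct
   and f_i in F (n = 0 allowed: empty sum) *)
Definition subset_sum (R : nzRingType) (k : nat) (F : seq (seq (entry R k)))
  (m : seq (entry R k)) : Prop :=
  exists (gs : seq (int * int)) (fs : seq (seq (entry R k))),
    [/\ size gs = size fs, uniq gs, all (fun f => f \in F) fs &
        forall g x, den m g x =
          \sum_(p <- zip gs fs) shift p.1 (den p.2) g x].

Definition nonzero_elt (R : nzRingType) (k : nat) (f : seq (entry R k)) : Prop :=
  exists g x, den f g x != 0.

Local Close Scope ring_scope.

Definition int_code (z : int) : nat :=
  match z with Posz n => n.*2 | Negz n => n.*2.+1 end.

Definition entry_code (R : nzRingType) (k : nat) (code : R -> nat)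
  (e : entry R k) : nat :=
  npair (npair (int_code e.1.1.1) (int_code e.1.1.2))
        (npair (nat_of_ord e.1.2) (code e.2)).

Fixpoint list_code (l : seq nat) : nat :=
  match l with [::] => 0 | h :: t => (npair h (list_code t)).+1 end.

Definition elt_code (R : nzRingType) (k : nat) (code : R -> nat)
  (m : seq (entry R k)) : nat := list_code (map (entry_code code) m).

(* Main.v *)
Require Import Defs.
From mathcomp Require Import all_boot all_order all_algebra.
From HB Require Import structures.
From mathcomp Require Import zify.
From Stdlib Require Import FunctionalExtensionality.
Set Implicit Arguments. Unset Strict Implicit. Unset Printing Implicit Defensive.
Import GRing.Theory.

(** The elements of F are Wang tiles: the tile placed at g has coefficient +1 at
    (g, west colour) and (g, south colour), and -1 at (g + (1,0), east colour) and
    (g + (0,1), north colour), so the colours of two neighbours cancel exactly when they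
    agree, and uncovered positions behave as blank tiles.  Two further basis elements are labels
    occurring with one sign only; prescribing m = label at (z,0) + label at (0,0) forces, over
    every nonzero ring, one start tile at the origin and one mark at distance z.

    A connected tiling then spells the run of a fixed nondeterministic counter program: a row is
    a word of tokens with a common control state, a counter is the number of cells
    carrying its token, and one step rewrites one cell.  The start row holds z tokens,
    followed by guessed free space.

    The fixed program computes from z the number n coding m itself, decodes z as a finite list
    of affine rules a M + r |-> b M + s, and runs them from the initial configuration of a
    register machine on input n.  Configurations are coded as a prime for the program counter times
    a product of powers of primes for the registers, and 0 is reached exactly when the
    machine halts with output 0.  Hence for every register machine p there is m with: m is a
    subset sum iff p answers 0 on m.  No p can decide the problem. *)

(** * Tiles and rows *)

Inductive rtc (T : Type) (r : T -> T -> Prop) : T -> T -> Prop :=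
| rtc_refl x : rtc r x x
| rtc_step x y z : r x y -> rtc r y z -> rtc r x z.

Lemma rtc1 T (r : T -> T -> Prop) x y : r x y -> rtc r x y.
Proof. by move=> h; apply: rtc_step h (rtc_refl _ _). Qed.

Lemma rtc_trans T (r : T -> T -> Prop) x y z : rtc r x y -> rtc r y z -> rtc r x z.
Proof. by elim=> // {}x u {}y rxu _ IH /IH; apply: rtc_step. Qed.

Section Tiles.

Variables (R : nzRingType).
Variables (Q Tok I : finType) (src tgt : I -> Q) (fr to : I -> Tok).
Variables (al : I -> Tok -> bool) (q0 qf : Q) (a0 a1 : Tok).

(* Horizontal colours: [inl b] in the bottom row, [b] telling whether the mark has been passed;
   [inr None] in the final row; [inr (Some (e, d))] in a row applying [e], [d] telling whether the
   changed cell has been passed.  A vertical colour records whether the cell is leftmost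
   ([Some false]), rightmost ([Some true]) or neither.  [None] is the blank colour. *)
Definition hcolor : finType := (bool + option (I * bool))%type.
Definition vcolor : finType := (option bool * (Q * Tok))%type.
Definition tile : finType :=
  (option hcolor * option hcolor * option vcolor * option vcolor * option bool)%type.
Definition west (t : tile) := t.1.1.1.1.
Definition east (t : tile) := t.1.1.1.2.
Definition south (t : tile) := t.1.1.2.
Definition north (t : tile) := t.1.2.
Definition lab (t : tile) := t.2.

(** From left to right: the start tile, the cells up to the mark, the mark, free cells, the right
    end. The mark is where the colour switches from [inl false] to [inl true]. *)
Definition bottoms : seq (option hcolor * option hcolor * option bool * Tok * option bool) :=
  [:: (None, Some (inl false), Some false, a0, Some false);
      (Some (inl false), Some (inl false), None, a0, None);
      (Some (inl false), Some (inl true), None, a1, Some true);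
      (Some (inl true), Some (inl true), None, a1, None);
      (Some (inl true), None, Some true, a1, None)].

Definition wall (b : bool) (h : hcolor) : option hcolor := if b then None else Some h.

(** The flag can only stay or rise, and it rises exactly at a changed cell. As [ok] asks for a
    lowered flag at the left end of a row and a raised one at the right end, each row changes
    exactly one cell, while [al] is checked in all of them. *)
Definition rewrites (e : I) (d d' : bool) (a a' : Tok) : bool :=
  al e a && (((a' == a) && (d' == d)) || [&& a == fr e, a' == to e, ~~ d & d']).

Definition ok (t : tile) : bool :=
  match south t, north t with
  | None, Some (c, (q, a)) =>
      (q == q0) && ((west t, east t, c, a, lab t) \in bottoms)
  | Some (c, (q, a)), None =>
      [&& q == qf, lab t == None, west t == wall (c == Some false) (inr None)
        & east t == wall (c == Some true) (inr None)]
  | Some (c, (q, a)), Some (c', (q', a')) =>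
      [&& c' == c, lab t == None &
        [exists e : I, exists d : bool, exists d' : bool,
          [&& src e == q, tgt e == q', rewrites e d d' a a',
              west t == wall (c == Some false) (inr (Some (e, d))),
              east t == wall (c == Some true) (inr (Some (e, d'))),
              (c == Some false) ==> ~~ d & (c == Some true) ==> d']]]
  | None, None => false
  end.

Definition basis : finType := (bool + (hcolor + vcolor))%type.

Local Open Scope ring_scope.

Definition opt_entry (g : int * int) (x : option basis) (c : R) : seq (entry R #|basis|) :=
  if x is Some x then [:: (g, enum_rank x, c)] else [::].

Definition bas_h (h : hcolor) : basis := inr (inl h).
Definition bas_v (v : vcolor) : basis := inr (inr v).
Definition bas_l (b : bool) : basis := inl b.

Definition elt (t : tile) : seq (entry R #|basis|) :=
  opt_entry (0, 0) (omap bas_h (west t)) 1 ++ opt_entry (1, 0) (omap bas_h (east t)) (-1) ++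
  opt_entry (0, 0) (omap bas_v (south t)) 1 ++ opt_entry (0, 1) (omap bas_v (north t)) (-1) ++
  opt_entry (0, 0) (omap bas_l (lab t)) 1.

Definition tile_set : seq (seq (entry R #|basis|)) := [seq elt t | t <- enum tile & ok t].

Definition target (z : nat) : seq (entry R #|basis|) :=
  [:: ((Posz z.+1, 0), enum_rank (bas_l true), 1); ((0, 0), enum_rank (bas_l false), 1)].

(** Labels are the first summand of [basis], so their ranks are the same whatever the colours are.
    The code of the target can therefore be built into the program from which the tiles are made. *)
Lemma bas_l_rank b : enum_rank (bas_l b) = index b (enum {: bool}) :> nat.
Proof.
have rankE (T : finType) (x : T) : enum_rank x = index x (enum T) :> nat.
  by rewrite -[x in RHS](nth_enum_rank x) index_uniq ?enum_uniq // -cardE.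
rewrite rankE [enum basis]enumT unlock /= /sum_enum index_cat -!enumT.
by rewrite map_f ?mem_enum // index_map //; move=> ? ? [].
Qed.

Lemma den_cat k (s1 s2 : seq (entry R k)) g x : den (s1 ++ s2) g x = den s1 g x + den s2 g x.
Proof. by rewrite /den big_cat. Qed.

Lemma den_opt_entry g o c g' y :
  den (opt_entry g o c) g' (enum_rank y) = if (g == g') && (o == Some y) then c else 0.
Proof.
case: o => [x|] /=; last by rewrite /den big_nil andbF.
rewrite /den big_cons big_nil /= addr0 (inj_eq enum_rank_inj).
by rewrite -(inj_eq (@Some_inj _)).
Qed.

Lemma omap_eqSome (A B : eqType) (f : A -> B) (o : option A) y :
  injective f -> (omap f o == Some (f y)) = (o == Some y).
Proof. by move=> fI; case: o => [x|] //=; rewrite !(inj_eq (@Some_inj _)) (inj_eq fI). Qed.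

Lemma den_eltH t g h : den (elt t) g (enum_rank (bas_h h)) =
  (if (g == (0, 0)) && (west t == Some h) then 1 else 0)
  - (if (g == (1, 0)) && (east t == Some h) then 1 else 0).
Proof.
have hI : injective bas_h by move=> ? ? [].
rewrite /elt !den_cat !den_opt_entry !(omap_eqSome _ _ hI) ![(_, _) == g]eq_sym.
case: (south t) (north t) (lab t) => [?|] [?|] [?|]; rewrite /= ?andbF !addr0;
by congr (_ + _); case: ifP; rewrite ?oppr0.
Qed.

Lemma den_eltV t g v : den (elt t) g (enum_rank (bas_v v)) =
  (if (g == (0, 0)) && (south t == Some v) then 1 else 0)
  - (if (g == (0, 1)) && (north t == Some v) then 1 else 0).
Proof.
have vI : injective bas_v by move=> ? ? [].
rewrite /elt !den_cat !den_opt_entry !(omap_eqSome _ _ vI) ![(_, _) == g]eq_sym.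
case: (west t) (east t) (lab t) => [?|] [?|] [?|]; rewrite /= ?andbF !addr0 !add0r;
by congr (_ + _); case: ifP; rewrite ?oppr0.
Qed.

Lemma den_eltL t g b : den (elt t) g (enum_rank (bas_l b)) =
  (if (g == (0, 0)) && (lab t == Some b) then 1 else 0).
Proof.
have lI : injective bas_l by move=> ? ? [].
rewrite /elt !den_cat !den_opt_entry !(omap_eqSome _ _ lI) ![(_, _) == g]eq_sym.
by case: (west t) (east t) (south t) (north t) => [?|] [?|] [?|] [?|];
  rewrite /= ?andbF !add0r.
Qed.

Lemma den_target z g x : den (target z) g (enum_rank x) =
  (if x is inl b then (if g == (if b then (Posz z.+1, 0) else (0, 0)) then 1 else 0) else 0).
Proof.
rewrite /den /target !big_cons big_nil /= !(inj_eq enum_rank_inj) ![(_, _) == g]eq_sym.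
by case: x => [[]|x] /=; rewrite ?andbF ?andbT ?addr0 ?add0r //; case: ifP; rewrite ?addr0.
Qed.

(** A valid tile has a vertical colour. South and north colours sit at different positions, so their
    coefficients cannot cancel. *)
Lemma tile_set_nonzero f : f \in tile_set -> nonzero_elt f.
Proof.
case/mapP=> t; rewrite mem_filter => /andP[okt _] ->.
case Es : (south t) => [v|].
  exists (0, 0), (enum_rank (bas_v v)).
  by rewrite den_eltV Es !eqxx /= subr0 oner_neq0.
case En : (north t) => [v|]; last by move: okt; rewrite /ok Es En.
exists (0, 1), (enum_rank (bas_v v)).
by rewrite den_eltV En !eqxx /= sub0r oppr_eq0 oner_neq0.
Qed.

(** * Subset sums as finite tilings *)

Definition tiling_by (z : nat) (tau : int * int -> option tile) : Prop :=
  [/\ forall g t, tau g = Some t -> ok t,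
      forall g, obind west (tau g) = obind east (tau (g.1 - 1, g.2)),
      forall g, obind south (tau g) = obind north (tau (g.1, g.2 - 1)) &
      forall g b, (obind lab (tau g) == Some b) = (g == if b then (Posz z.+1, 0) else (0, 0))].

Fixpoint lookup (l : seq ((int * int) * tile)) (g : int * int) : option tile :=
  if l is (g', t) :: l' then (if g' == g then Some t else lookup l' g) else None.

Lemma lookup_notin l g : g \notin unzip1 l -> lookup l g = None.
Proof.
by elim: l => //= -[g' t] l IH; rewrite inE negb_or eq_sym => /andP[/negbTE -> /IH].
Qed.

Lemma lookup_mem l g t : lookup l g = Some t -> (g, t) \in l.
Proof.
elim: l => //= -[g' t'] l IH; case: eqP => [-> [->]|_ /IH H]; rewrite inE ?eqxx //.
by rewrite H orbT.
Qed.

Lemma lookupP l g t : uniq (unzip1 l) -> (g, t) \in l -> lookup l g = Some t.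
Proof.
elim: l => //= -[g' t'] l IH /andP[gl ul]; rewrite inE => /predU1P[[-> ->]|gt].
  by rewrite eqxx.
case: eqP => [e|_]; last exact: IH.
by case/negP: gl; rewrite e; apply: (map_f fst gt).
Qed.

Lemma sum_lookup (A : eqType) (f : tile -> option A) (a : A) (l : seq ((int * int) * tile)) g0 :
  uniq (unzip1 l) ->
  \sum_(p <- l) (if (p.1 == g0) && (f p.2 == Some a) then 1 else 0 : R) =
  (if obind f (lookup l g0) == Some a then 1 else 0).
Proof.
elim: l => [|[g t] l IH] /=; first by rewrite big_nil.
move=> /andP[gl ul]; rewrite big_cons /= IH //; case: eqP => [e|_] /=; last by rewrite add0r.
by rewrite lookup_notin -?e //= addr0.
Qed.

Definition tsum (l : seq ((int * int) * tile)) (g : int * int) (x : 'I_#|basis|) : R :=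
  \sum_(p <- l) shift p.1 (den (elt p.2)) g x.

Lemma sub_pair_eq (g p d : int * int) :
  ((g.1 - p.1, g.2 - p.2) == d) = (p == (g.1 - d.1, g.2 - d.2)).
Proof.
case: g p d => [g1 g2] [p1 p2] [d1' d2'] /=; rewrite !xpair_eqE; congr (_ && _); lia.
Qed.

Lemma tsumH l g h : uniq (unzip1 l) -> tsum l g (enum_rank (bas_h h)) =
  (if obind west (lookup l g) == Some h then 1 else 0)
  - (if obind east (lookup l (g.1 - 1, g.2)) == Some h then 1 else 0).
Proof.
move=> ul; rewrite /tsum /shift.
under eq_bigr => p _ do rewrite den_eltH !sub_pair_eq /= !subr0.
by rewrite sumrB -surjective_pairing !sum_lookup.
Qed.

Lemma tsumV l g v : uniq (unzip1 l) -> tsum l g (enum_rank (bas_v v)) =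
  (if obind south (lookup l g) == Some v then 1 else 0)
  - (if obind north (lookup l (g.1, g.2 - 1)) == Some v then 1 else 0).
Proof.
move=> ul; rewrite /tsum /shift.
under eq_bigr => p _ do rewrite den_eltV !sub_pair_eq /= !subr0.
by rewrite sumrB -surjective_pairing !sum_lookup.
Qed.

Lemma tsumL l g b : uniq (unzip1 l) -> tsum l g (enum_rank (bas_l b)) =
  (if obind lab (lookup l g) == Some b then 1 else 0).
Proof.
move=> ul; rewrite /tsum /shift.
under eq_bigr => p _ do rewrite den_eltL !sub_pair_eq /= !subr0.
by rewrite -surjective_pairing sum_lookup.
Qed.

Lemma indicator_inj (a b : bool) : (if a then 1 else 0 : R) = (if b then 1 else 0) -> a = b.
Proof.
have N : (1 : R) <> 0 by apply/eqP; rewrite oner_neq0.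
by case: a; case: b => // E; case: N.
Qed.

Lemma option_eq_ext (A : eqType) (o o' : option A) :
  (forall a, (o == Some a) = (o' == Some a)) -> o = o'.
Proof.
case: o o' => [a|] [a'|] // H.
- by have := H a'; rewrite eqxx => /eqP.
- by have := H a; rewrite eqxx.
by have := H a'; rewrite eqxx.
Qed.

(** The coefficient of a colour is a difference of two indicators, which vanishes in a nonzero ring
    exactly when the two agree, whatever the characteristic. The coefficient of a label is a single
    indicator, so the target prescribes the positions of the labels. *)
Lemma tsum_targetP z l : uniq (unzip1 l) -> all (fun p => ok p.2) l ->
  (forall g x, den (target z) g x = tsum l g x) <-> tiling_by z (lookup l).
Proof.
move=> ul okl; split=> [H|[_ Hw Hs Hl] g x].
  have {}H g x : den (target z) g (enum_rank x) = tsum l g (enum_rank x) by [].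
  split=> [g t /lookup_mem gt|g|g|g b]; first exact: (allP okl _ gt).
  - apply: option_eq_ext => h; apply: indicator_inj; apply/eqP.
    by rewrite -subr_eq0 -tsumH // -H den_target.
  - apply: option_eq_ext => h; apply: indicator_inj; apply/eqP.
    by rewrite -subr_eq0 -tsumV // -H den_target.
  by apply: indicator_inj; rewrite -tsumL // -H den_target.
rewrite -[x]enum_valK den_target; case: (enum_val x) => [b|[h|v]].
- by rewrite (tsumL _ b ul) Hl.
- by rewrite (tsumH _ h ul) Hw subrr.
by rewrite (tsumV _ v ul) Hs subrr.
Qed.

Lemma subset_sum_tiling z :
  subset_sum tile_set (target z) <->
  exists2 l, uniq (unzip1 l) & tiling_by z (lookup l).
Proof.
split=> [[gs [fs [szE ugs fsF H]]]|[l ul Hl]].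
  (* Injectivity of [elt] is avoided: each summand is replaced by some valid tile that yields it. *)
  have [ts okts fsE] : exists2 ts, all ok ts & fs = map elt ts.
    elim: fs fsF {szE H} => [|f fs IH] /=; first by exists [::].
    case/andP=> /mapP[t + ->] /IH[ts okts ->]; rewrite mem_filter => /andP[okt _].
    by exists (t :: ts); rewrite //= okt.
  subst fs; rewrite size_map in szE; exists (zip gs ts); first by rewrite unzip1_zip ?szE.
  apply/tsum_targetP; rewrite ?unzip1_zip ?szE //.
    apply/allP=> -[g t] /(map_f snd); rewrite -/(unzip2 _) unzip2_zip ?szE //=.
    exact: (allP okts).
  move=> g x; rewrite H /tsum.
  have -> : zip gs (map elt ts) = [seq (p.1, elt p.2) | p <- zip gs ts].
    by elim: gs ts {szE ugs fsF H okts} => [|g' gs IH] [|t ts] //=; rewrite IH.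
  by rewrite big_map.
have okl : all (fun p => ok p.2) l.
  by apply/allP=> -[g t] gt; have [okl _ _ _] := Hl; apply: okl (lookupP ul gt).
exists (unzip1 l), (map elt (unzip2 l)); split=> //; first by rewrite !size_map.
  rewrite all_map; apply/allP=> t /mapP[p pl ->] /=; apply: map_f.
  by rewrite mem_filter mem_enum andbT; apply: (allP okl).
have /(tsum_targetP z ul okl) H := Hl; move=> g x; rewrite H /tsum.
have -> : zip (unzip1 l) (map elt (unzip2 l)) = [seq (p.1, elt p.2) | p <- l].
  by elim: l {ul Hl okl H} => [|p l IH] //=; rewrite IH.
by rewrite big_map.
Qed.

Local Close Scope ring_scope.

Definition set_at (w : nat -> Tok) (j : nat) (a : Tok) : nat -> Tok :=
  fun i => if i == j then a else w i.

Definition row_step (n : nat) (s s' : Q * (nat -> Tok)) : Prop :=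
  exists e j, [/\ j < n, s.1 = src e /\ s'.1 = tgt e, forall i, i < n -> al e (s.2 i),
                  s.2 j = fr e & s'.2 = set_at s.2 j (to e)].

Definition init_row (z i : nat) : Tok := if i <= z then a0 else a1.

Definition cls (n i : nat) : option bool :=
  if i == 0 then Some false else if i.+1 == n then Some true else None.

Lemma cls_left n i : (cls n i == Some false) = (i == 0).
Proof. by rewrite /cls; case: (i =P 0) => // _; case: (i.+1 =P n). Qed.

Lemma cls_right n i : 1 < n -> (cls n i == Some true) = (i.+1 == n).
Proof.
rewrite /cls => n1; case: (i =P 0) => [->|_]; last by case: (i.+1 =P n).
by case: n n1 => [|[]].
Qed.

(** Labels and the colours [inl b] occur in bottom tiles only, so either of them identifies the
    bottom row. *)
Lemma ok_bottom t : ok t -> (exists b, west t = Some (inl b)) \/ (exists b, lab t = Some b) ->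
  exists c a, north t = Some (c, (q0, a)) /\ (west t, east t, c, a, lab t) \in bottoms.
Proof.
rewrite /ok; case: (south t) (north t) => [[c [q a]]|] [[c' [q' a']]|] //.
- case/and3P=> _ /eqP-> /existsP[e /existsP[d /existsP[d']]].
  case/and5P=> _ _ _ /eqP-> _ [] [b] //; by case: (_ == _).
- by case/and4P=> _ /eqP-> /eqP-> _ [] [b] //; case: (_ == _).
by case/andP=> /eqP-> H _; exists c', a'.
Qed.

(** * From a tiling to an accepting run *)

Section Follow.
Variables (z b : nat) (tau : nat -> nat -> option tile).
Hypothesis fin_tau : forall i t, (b <= i) || (b <= t) -> tau i t = None.
Hypothesis ok_tau : forall i t u, tau i t = Some u -> ok u.
Hypothesis west_tau : forall i t, obind west (tau i.+1 t) = obind east (tau i t).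
Hypothesis south_tau : forall i t, obind south (tau i t.+1) = obind north (tau i t).
Hypothesis lab_start : obind lab (tau 0 0) = Some false.
Hypothesis lab_mark : forall i, (obind lab (tau i 0) == Some true) = (i == z.+1).

Definition row_at n t q (w : nat -> Tok) :=
  forall i, i < n -> obind north (tau i t) = Some (cls n i, (q, w i)).

(** The label at the origin forces the start tile, whose east colour forces a tile to its right, and
    so on. Up to column [z] the absence of the label [true] rules out the mark, and the only other
    tile with west colour [inl false] continues the row. *)
Lemma start_cells i : i <= z ->
  obind east (tau i 0) = Some (inl false) /\
  obind north (tau i 0) = Some (if i == 0 then Some false else None, (q0, a0)).
Proof.
elim: i => [|i IH] iz.
  move: lab_start; case E : (tau 0 0) => [t|] //= lt.
  have [|c [a [-> ]]] := ok_bottom (ok_tau E); first by right; exists false.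
  by rewrite lt !inE => /orP[|/or4P[]] /eqP[] // _ -> -> ->.
have [e1 _] := IH (ltnW iz); have := west_tau i 0; rewrite e1.
have lm := lab_mark i.+1; rewrite eqSS [i == z]ltn_eqF // in lm.
case E : (tau i.+1 0) lm => [t|] //= /eqP lt wt.
have [|c [a [-> ]]] := ok_bottom (ok_tau E); first by left; exists false.
by rewrite wt !inE => /orP[|/or4P[]] /eqP[] // -> -> -> // lE; case: lt; rewrite lE.
Qed.

Lemma mark_cell : obind east (tau z.+1 0) = Some (inl true) /\
  obind north (tau z.+1 0) = Some (None, (q0, a1)).
Proof.
have [e1 _] := start_cells (leqnn z); have := west_tau z 0; rewrite e1.
have := lab_mark z.+1; rewrite eqxx.
case E : (tau z.+1 0) => [t|] //= /eqP lt wt.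
have [|c [a [-> ]]] := ok_bottom (ok_tau E); first by left; exists false.
by rewrite wt lt !inE => /orP[|/or4P[]] /eqP[] // -> -> ->.
Qed.

(** Right of the mark, each tile closes the row or hands on the colour [inl true]; only [k] cells
    are inspected, so the row may still be open. *)
Lemma pad_cells k :
  (exists2 m, forall j, j < m -> obind north (tau (z.+2 + j) 0) = Some (None, (q0, a1)) &
     obind north (tau (z.+2 + m) 0) = Some (Some true, (q0, a1))) \/
  (obind east (tau (z.+1 + k) 0) = Some (inl true) /\
   forall j, j < k -> obind north (tau (z.+2 + j) 0) = Some (None, (q0, a1))).
Proof.
elim: k => [|k [IH|[e1 IH]]]; [|by left|].
  by right; split=> //; rewrite addn0; have [] := mark_cell.
have := west_tau (z.+1 + k) 0; rewrite e1 -addSn.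
have := lab_mark (z.+2 + k); rewrite (_ : (z.+2 + k == z.+1) = false); last by lia.
case E : (tau (z.+2 + k) 0) => [t|] //= lt wt.
have [|c [a [Nt]]] := ok_bottom (ok_tau E); first by left; exists true.
rewrite wt !inE => /orP[|/or4P[]] /eqP[] // Et Ec Ea El; rewrite Ec Ea in Nt.
  right; rewrite (_ : z.+1 + k.+1 = z.+2 + k) ?E /= ?Et; last by lia.
   split=> // j; rewrite ltnS leq_eqVlt => /predU1P[->|/IH] //.
  by rewrite E.
by left; exists k => //; rewrite E.
Qed.

Lemma bottom_row : exists2 n, z.+2 < n & row_at n 0 q0 (init_row z).
Proof.
(* After [b] cells the support is left behind and no colour can be handed on, so the row has been
   closed. *)
have [[m Hm Hend]|[]] := pad_cells b; last first.
  by rewrite fin_tau // leq_addl.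
exists (z.+3 + m); first by rewrite !addSn !ltnS leq_addr.
move=> i iz; rewrite /cls /init_row.
have [iz1|zi] := leqP i z.
  have [_ ->] := start_cells iz1; congr (Some (_, _)).
  by case: eqP => // _; case: eqP => //; lia.
case: (i =P 0) => [|_]; first by lia.
have [->|iz2] := i =P z.+1; first by have [_ ->] := mark_cell; case: eqP => //; lia.
have -> : i = z.+2 + (i - z.+2) by lia.
case: eqP => [im|im]; last by rewrite Hm //; lia.
by rewrite -Hend; congr (obind north (tau _ _)); lia.
Qed.

(** The north colours of the row force a tile above each cell. The leftmost one decides: its north
    side may be blank only in state [qf]; otherwise the horizontal colours carry its edge [e]
    through the whole row. *)
Lemma next_row n t q w : 1 < n -> row_at n t q w ->
  q = qf \/ exists q' w', row_step n (q, w) (q', w') /\ row_at n t.+1 q' w'.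
Proof.
move=> n1 row.
have cell i : i < n -> exists2 u, tau i t.+1 = Some u & south u = Some (cls n i, (q, w i)).
  by move=> /row; rewrite -south_tau; case: (tau i t.+1) => [u|] //= H; exists u.
have [u0 E0 S0] := cell 0 (ltnW n1).
have := ok_tau E0; rewrite /ok S0 cls_left cls_right // eqxx eqn_leq [n <= 1]leqNgt n1 andbF.
case N0 : (north u0) => [[c' [q' a']]|]; last by case/and4P=> /eqP; left.
case/and3P=> /eqP c'E _ /existsP[e /existsP[d /existsP[d']]].
case/and5P=> /eqP qe /eqP qe' rw0 /eqP We /and3P[/eqP Ee /negbTE d0 _]; right.
rewrite {}d0 in rw0 We.
(* Sweep over the first [m] cells: [w'] is the row written so far, and [d] tells whether the changed
   cell is among them. At [m = n] the right wall forces [d]. *)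
have main m : 0 < m <= n -> exists w' d,
  [/\ forall i, i < m -> obind north (tau i t.+1) = Some (cls n i, (q', w' i)) /\ al e (w i),
      obind east (tau m.-1 t.+1) = wall (m == n) (inr (Some (e, d))),
      (m == n) ==> d &
      if d then exists2 j, j < m & w j = fr e /\ w' = set_at w j (to e) else w' = w].
  elim: m => // m IH mn; have [m0|m0] := posnP m.
    subst m; case/andP: rw0 => al0 /orP[/andP[/eqP a'E /eqP d'E]|/and4P[/eqP wE /eqP a'E _ d'E]].
      exists w, false; rewrite E0 /= Ee d'E; split; rewrite ?(ltn_eqF n1) //; case=> //= _.
      by rewrite E0 /= N0 a'E c'E.
    exists (set_at w 0 (to e)), true; rewrite E0 /= Ee d'E; split; rewrite ?(ltn_eqF n1) //; last by exists 0.
    by case=> //= _; rewrite E0 /= N0 a'E c'E /set_at.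
  case/andP: mn => _ mn; have [|w' [d1 [Hw He _ Hd]]] := IH; first by rewrite m0 ltnW.
  have [u Eu Su] := cell m mn; have := west_tau m.-1 t.+1.
  rewrite prednK // He Eu /= ltn_eqF //= => Wu; have := ok_tau Eu.
  rewrite /ok Su cls_left cls_right // [m == 0]gtn_eqF //= Wu.
  case Nu : (north u) => [[c2 [q2 a2]]|]; last by case/and4P.
  case/and3P=> /eqP c2E _ /existsP[e2 /existsP[d2 /existsP[d3]]].
  case/and5P=> _ /eqP qe2 rw2 /eqP[ee dd] /andP[/eqP Ee2 last_d].
  subst e2 d2; case/andP: rw2 => al2.
  have extend (w2 : nat -> Tok) : (forall i, i < m -> w2 i = w' i) -> w2 m = a2 ->
     forall i, i < m.+1 -> obind north (tau i t.+1) = Some (cls n i, (q', w2 i)) /\ al e (w i).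
    move=> w2w w2m i; rewrite ltnS leq_eqVlt => /predU1P[->|im]; last by rewrite w2w //; apply: Hw.
    by rewrite Eu /= Nu c2E -qe2 qe' w2m.
  case/orP=> [/andP[/eqP a2E /eqP d3E]|/and4P[/eqP wE /eqP a2E /negbTE d1E d3E]].
    exists w', d1; rewrite /= Ee2 d3E; split=> //.
    - apply: extend => //; rewrite a2E; case: d1 Hd {He Wu Ee2 last_d d3E} => [[j jm [_ ->]]|->] //.
      by rewrite /set_at gtn_eqF.
    - by rewrite -d3E.
    by case: d1 Hd {He Wu Ee2 last_d d3E} => // -[j jm Hj]; exists j => //; apply: ltnW.
  subst d1; rewrite /= in Hd; exists (set_at w m (to e)), true; rewrite /= Ee2 d3E; split=> //.
  - apply: extend => [i im|]; first by rewrite Hd /set_at ltn_eqF.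
    by rewrite /set_at eqxx a2E.
  - exact: implybT.
  by exists m.
have [|w' [d1 [Hw _]]] := main n; first by rewrite leqnn ltnW.
rewrite eqxx /= => -> [j jn [wj w'E]]; exists q', w'; split; last by move=> i /Hw[].
by exists e, j; split=> // i /Hw[].
Qed.

(** Finite support bounds the height, so the ascent stops, and it can stop only in state [qf]. The
    induction is on the distance to the bound [b]. *)
Lemma rows_accept n t q w : 1 < n -> row_at n t q w ->
  exists w', rtc (row_step n) (q, w) (qf, w').
Proof.
move=> n1; have [k] : exists k, b <= t + k by exists b; apply: leq_addl.
elim: k t q w => [|k IH] t q w bt row.
  by rewrite addn0 in bt; have := row 0 (ltnW n1); rewrite fin_tau // bt orbT.
case: (next_row n1 row) => [->|[q' [w' [stp row']]]]; first by exists w; apply: rtc_refl.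
have [|w2 H] := IH _ _ _ _ row'; first by rewrite addSnnS.
by exists w2; apply: rtc_step H.
Qed.

End Follow.

(** * From a run to a tiling *)

Definition block n q w T (G : nat -> nat -> tile) : Prop :=
 [/\ forall i t, i < n -> t <= T -> ok (G i t) /\ lab (G i t) = None,
     forall i, i < n -> south (G i 0) = Some (cls n i, (q, w i)),
     forall i t, i < n -> t < T -> south (G i t.+1) = north (G i t),
     forall i, i < n -> north (G i T) = None &
     forall t, t <= T -> [/\ west (G 0 t) = None, east (G n.-1 t) = None &
        forall i, i.+1 < n -> west (G i.+1 t) = east (G i t)]].

Lemma block_final n w : 1 < n ->
  block n qf w 0 (fun i _ => (wall (i == 0) (inr None), wall (i.+1 == n) (inr None),
                              Some (cls n i, (qf, w i)), None, None)).
Proof.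
move=> n1; split=> // [i t lin _|t _]; first by rewrite /ok /= cls_left cls_right // !eqxx.
split; rewrite /west /east /= ?prednK ?eqxx //; first exact: ltnW.
by move=> i lin; rewrite ltn_eqF.
Qed.

(** The block grows downwards, against the direction of the run: a row of tiles applying [e] is put
    below it. *)
Lemma block_step n q w q' w' T G : 1 < n -> row_step n (q, w) (q', w') ->
  block n q' w' T G -> exists G', block n q w T.+1 G'.
Proof.
move=> n1 [e [j [jn [/= qE q'E] ale wj w'E]]] [Gok Gs GV Gn GH].
(* The two flags tell whether cell [j] lies left of the west edge and left of the east edge of cell
   [i]; they differ only at [i = j]. *)
pose row i : tile := (wall (i == 0) (inr (Some (e, j < i))),
  wall (i.+1 == n) (inr (Some (e, j < i.+1))), Some (cls n i, (q, w i)),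
  Some (cls n i, (q', w' i)), None).
exists (fun i t => if t is t'.+1 then G i t' else row i); split=> //.
- move=> i [|t] lin; last exact: Gok.
  split=> //; rewrite /ok /= cls_left cls_right // eqxx /=.
  apply/existsP; exists e; apply/existsP; exists (j < i); apply/existsP; exists (j < i.+1).
  rewrite qE q'E !eqxx /west /east /=; apply/and3P; split.
  + rewrite /rewrites ale // w'E /set_at ltnS [j <= i]leq_eqVlt [j == i]eq_sym.
    by case: (i =P j) => [->|_] /=; rewrite ?eqxx // ltnn wj eqxx orbT.
  + by apply/implyP=> /eqP->.
  by apply/implyP=> /eqP->.
- by move=> i [|t] lin //; [rewrite Gs|apply: GV].
move=> [|t] //; last by rewrite ltnS; apply: GH.
split; rewrite /west /east /= ?prednK ?eqxx //; first exact: ltnW.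
by move=> i lin; rewrite ltn_eqF.
Qed.

Lemma block_of_run n s s' : 1 < n -> rtc (row_step n) s s' -> s'.1 = qf ->
  exists T G, block n s.1 s.2 T G.
Proof.
move=> n1; elim=> [[q w] /= ->|[q w] [q' w'] {}s' stp _ IH /IH[T [G GB]]].
  by exists 0; eexists; apply: block_final.
by have [G' G'B] := block_step n1 stp GB; exists T.+1, G'.
Qed.

Lemma tiling_of_block z n T G : z.+2 < n -> block n q0 (init_row z) T G ->
  exists2 l, uniq (unzip1 l) & tiling_by z (lookup l).
Proof.
move=> zn [Gok Gs GV Gn GH].
(* The colour switches at the mark in column [z.+1]. The rows of the block move up by one to make
   room for this row, whence the height [T.+2] of the grid. *)
pose bot i : tile := (wall (i == 0) (inl (z.+1 < i)), wall (i.+1 == n) (inl (z.+1 < i.+1)),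
  None, Some (cls n i, (q0, init_row z i)),
  if i == 0 then Some false else if i == z.+1 then Some true else None).
pose H i t := if t is t'.+1 then G i t' else bot i.
pose pos (p : nat * nat) : int * int := (Posz p.1, Posz p.2).
have posI : injective pos by move=> [? ?] [? ?] [-> ->].
pose grid := [seq (i, t) | i <- iota 0 n, t <- iota 0 T.+2].
pose l := [seq (pos p, H p.1 p.2) | p <- grid].
have l1 : unzip1 l = map pos grid by rewrite /unzip1 -map_comp.
have ul : uniq (unzip1 l).
  by rewrite l1 map_inj_uniq // allpairs_uniq ?iota_uniq // => -[? ?] [? ?] _ _ [-> ->].
have lE i t : lookup l (Posz i, Posz t) = if (i < n) && (t < T.+2) then Some (H i t) else None.
  have gridE : ((i, t) \in grid) = (i < n) && (t < T.+2).
    apply/allpairsP/idP => [[p []]|/andP[lin tT]].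
      by rewrite !mem_iota !add0n => pn pT [-> ->]; apply/andP.
    by exists (i, t); rewrite !mem_iota !add0n lin tT.
  rewrite -gridE; case: ifP => it.
    by apply: lookupP => //; apply/mapP; exists (i, t).
  by apply: lookup_notin; rewrite l1 -/(pos (i, t)) mem_map // it.
have lN x y : (x < 0)%R || (y < 0)%R -> lookup l (x, y) = None.
  move=> xy; apply: lookup_notin; rewrite l1; apply/negP=> /mapP[[i t] _ [xE yE]].
  by rewrite xE yE in xy.
have n1 : 1 < n by lia.
have n_gt0 : 0 < n by lia.
have Hrow t : t < T.+2 -> [/\ west (H 0 t) = None, east (H n.-1 t) = None &
    forall i, i.+1 < n -> west (H i.+1 t) = east (H i t)].
  case: t => [|t] /=; last by rewrite ltnS; apply: GH.
  move=> _; split; rewrite /west /east /= ?prednK ?eqxx //.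
  by move=> i lin; rewrite ltn_eqF.
have Hcol i t : i < n -> t.+1 < T.+2 -> south (H i t.+1) = north (H i t).
  by case: t => [|t] lin tT /=; [apply: Gs|apply: GV].
exists l => //; split.
- move=> [[i|i] [t|t]] u; try by rewrite lN.
  rewrite lE; case: ifP => // /andP[lin]; case: t => [|t] tT [<-] /=; last by case: (Gok i t).
  rewrite /ok /= eqxx /west /east /cls /init_row /lab /= /wall.
  have [->|i0] := eqVneq i 0; first by rewrite (ltn_eqF n1) !inE !eqxx.
  have [iz|zi|->] := ltngtP i z.+1.
  + have -> : (i.+1 == n) = false by lia.
    have -> : (z.+1 < i.+1) = false by lia.
    by have -> : i <= z by []; rewrite !inE !eqxx orbT.
  + have -> : (z.+1 < i.+1) = true by lia.
    have -> : (i <= z) = false by lia.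
    by case: eqP => _; rewrite !inE !eqxx ?orbT.
  by rewrite (ltn_eqF zn) ltnSn ltnn !inE !eqxx !orbT.
- move=> [[i|i] [t|t]] /=; try by rewrite !lN //; lia.
  case: i => [|i].
    rewrite lE lN //; case: ifP => // /andP[_ tT] /=; by have [] := Hrow t tT.
  have -> : (Posz i.+1 - 1)%R = Posz i by lia.
  rewrite !lE; have [tT|] := ltnP t T.+2; rewrite ?andbF // !andbT.
  have [Hw He HE] := Hrow t tT.
  have [lin|nl] := ltnP i.+1 n; first by rewrite (ltnW lin) /= HE.
  by case: ltnP => // lin; have -> : i = n.-1 by lia.
- move=> [[i|i] [t|t]] /=; try by rewrite !lN //; lia.
  case: t => [|t].
    by rewrite lE lN ?orbT //; case: ifP.
  have -> : (Posz t.+1 - 1)%R = Posz t by lia.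
  rewrite !lE; have [lin|//] := ltnP i n; rewrite /=.
  have [tT|tT] := ltnP t.+1 T.+2; first by rewrite (ltnW tT); apply: Hcol.
  case: ltnP => // tT2; have -> : t = T.+1 by lia.
  by rewrite /= Gn.
move=> [[i|i] [t|t]] c; try by rewrite lN ?orbT //; case: c; rewrite xpair_eqE ?andbF.
rewrite lE; case: t => [|t]; last first.
  case: ifP => [/andP[lin tT]|_]; first by have [//|_ labE] := Gok i t lin;
    rewrite /= labE; case: c; rewrite xpair_eqE andbF.
  by case: c; rewrite xpair_eqE andbF.
rewrite andbT; have [lin|nl] := ltnP i n; case: c; rewrite /= xpair_eqE andbT /lab /= ?eqz_nat.
- by case: (i =P 0) => [e|_]; [rewrite ?e|case: (i =P z.+1)].
- by case: (i =P 0) => [e|_]; [rewrite ?e|case: (i =P z.+1)].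
- by have -> : (i == z.+1) = false by lia.
by have -> : (i == 0) = false by lia.
Qed.

(** The bound [z.+2 < n] leaves room for [z.+1] initial tokens, the mark and the right end. *)
Theorem subset_sum_run z :
  subset_sum tile_set (target z) <->
  exists n w, z.+2 < n /\ rtc (row_step n) (q0, init_row z) (qf, w).
Proof.
rewrite subset_sum_tiling; split=> [[l ul [Hok Hw Hs Hl]]|[n [w [zn run]]]]; last first.
  have n1 : 1 < n by apply: leq_ltn_trans zn.
  by have [T [G]] := block_of_run n1 run erefl; apply: tiling_of_block.
pose tau i t := lookup l (Posz i, Posz t).
(* [b] exceeds the absolute value of every coordinate in the support; [tau] is the tiling on the
   quadrant of non-negative coordinates. *)
pose b := \max_(g <- unzip1 l) (maxn (absz g.1) (absz g.2)).+1.
have finl i t : (b <= i) || (b <= t) -> tau i t = None.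
  move=> bit; case E : (tau i t) => [u|//].
  have gl : (Posz i, Posz t) \in unzip1 l by apply: (map_f fst (lookup_mem E)).
  have /= := leq_bigmax_seq (P := xpredT) (F := fun g : int * int => (maxn (absz g.1) (absz g.2)).+1)
    _ gl isT.
  by rewrite -/b; lia.
have ok_tau i t u : tau i t = Some u -> ok u by apply: Hok.
have west_tau i t : obind west (tau i.+1 t) = obind east (tau i t).
  by rewrite /tau Hw /=; have -> : (Posz i.+1 - 1)%R = Posz i by lia.
have south_tau i t : obind south (tau i t.+1) = obind north (tau i t).
  by rewrite /tau Hs /=; have -> : (Posz t.+1 - 1)%R = Posz t by lia.
have start : obind lab (tau 0 0) = Some false by apply/eqP; rewrite Hl.
have mark i : (obind lab (tau i 0) == Some true) = (i == z.+1).
  by rewrite Hl xpair_eqE andbT.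
have [n zn row] := bottom_row finl ok_tau west_tau start mark.
have n1 : 1 < n by apply: leq_ltn_trans zn.
by have [w run] := rows_accept finl ok_tau west_tau south_tau n1 row; exists n, w.
Qed.

Lemma elt_code_target (code : R -> nat) z : elt_code code (target z) =
  (npair (npair (npair z.+1.*2 0) (npair (index true (enum {: bool})) (code 1%R)))
         (npair (npair (npair 0 0) (npair (index false (enum {: bool})) (code 1%R))) 0).+1).+1.
Proof. by rewrite -!bas_l_rank. Qed.

End Tiles.

(** * Nondeterministic counter programs *)

Section Commands.

Variable K : nat.

Inductive cmd := Inc of 'I_K | Dec of 'I_K | Zero of 'I_K | Seq of cmd & cmd | Star of cmd.

Definition cmd_eq_dec : comparable cmd.
Proof.
move=> c d; rewrite /decidable; decide equality; exact: eq_comparable.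
Defined.

HB.instance Definition _ := hasDecEq.Build cmd (compareP cmd_eq_dec).

Fixpoint sem (c : cmd) (s s' : nat -> nat) : Prop :=
  match c with
  | Inc v => s' = upd s v (s v).+1
  | Dec v => 0 < s v /\ s' = upd s v (s v).-1
  | Zero v => s v = 0 /\ s' = s
  | Seq c d => exists2 u, sem c s u & sem d u s'
  | Star c => rtc (sem c) s s'
  end.

Definition token : finType := option 'I_K.
(* (x, y, f): one cell changes from x to y, and no cell may hold a forbidden token f *)
Definition op : finType := (token * token * option token)%type.

(** The control state is a stack of commands still to be run. A row always rewrites one cell, so
    steps that leave the counters alone replace a free cell by itself. A zero test takes a single
    row, since every cell of the row checks the forbidden token. *)
Definition cstep (k : seq cmd) (o : op) (k' : seq cmd) : bool :=
  match k with
  | [::] => false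
  | Inc v :: k1 => (k' == k1) && (o == (None, Some v, None))
  | Dec v :: k1 => (k' == k1) && (o == (Some v, None, None))
  | Zero v :: k1 => (k' == k1) && (o == (None, None, Some (Some v)))
  | Seq c d :: k1 => (k' == [:: c, d & k1]) && (o == (None, None, None))
  | Star c :: k1 => ((k' == k1) || (k' == [:: c, Star c & k1])) && (o == (None, None, None))
  end.

(** The stacks met while [c] runs on top of [k], similar to the partial derivatives of a regular
    expression. There are finitely many because the body of a [Star] returns to the very stack from
    which it was entered; this makes the control finite. *)
Fixpoint conts (c : cmd) (k : seq cmd) : seq (seq cmd) :=
  (c :: k) :: match c with
  | Seq c d => conts c (d :: k) ++ conts d k
  | Star c1 => conts c1 (c :: k)
  | _ => [::]
  end.

Lemma conts_head c k : c :: k \in conts c k.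
Proof. by case: c => *; rewrite inE eqxx. Qed.

Lemma conts_nil c k : [::] \notin conts c k.
Proof.
elim: c k => [v|v|v|c IHc d IHd|c IHc] k //=; last exact: IHc.
by rewrite inE mem_cat !negb_or IHc IHd.
Qed.

Lemma conts_closed c k x o y : x \in conts c k -> cstep x o y -> y \in k :: conts c k.
Proof.
elim: c k => [v|v|v|c IHc d IHd|c IHc] k /=; rewrite inE.
- by move/eqP=> -> /= /andP[/eqP-> _]; rewrite inE eqxx.
- by move/eqP=> -> /= /andP[/eqP-> _]; rewrite inE eqxx.
- by move/eqP=> -> /= /andP[/eqP-> _]; rewrite inE eqxx.
- move/predU1P=> [-> /= /andP[/eqP-> _]|]; first by rewrite !inE mem_cat conts_head !orbT.
  rewrite mem_cat => /orP[/IHc H /H|/IHd H /H]; rewrite !inE mem_cat.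
    by case/predU1P=> [->|->]; rewrite ?conts_head !orbT.
  by case/predU1P=> [->|->]; rewrite ?eqxx ?orbT.
move/predU1P=> [-> /= /andP[/orP[/eqP->|/eqP->] _]|]; rewrite ?inE ?eqxx //.
  by rewrite conts_head !orbT.
by move/IHc=> H /H; rewrite !inE => /predU1P[->|->]; rewrite ?eqxx ?orbT.
Qed.

Definition allowed (o : op) (x : token) : bool := o.2 != Some x.

Definition word_step (n : nat) (o : op) (w w' : nat -> token) : Prop :=
  exists j, [/\ j < n, forall i, i < n -> allowed o (w i), w j = o.1.1 & w' = set_at w j o.1.2].

Definition conf_step (n : nat) (s s' : seq cmd * (nat -> token)) : Prop :=
  exists2 o, cstep s.1 o s'.1 & word_step n o s.2 s'.2.

(** Comparing tokens through [nat_of_ord] makes the counts a function on all of nat, as the states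
    of [sem] are, with value 0 from [K] on. *)
Definition count_tok (n : nat) (w : nat -> token) (x : option nat) : nat :=
  \sum_(i < n) (omap (@nat_of_ord K) (w i) == x).

Definition counts n w : nat -> nat := fun v => count_tok n w (Some v).

Lemma count_set_at n w j y x : j < n ->
  count_tok n (set_at w j y) x + (omap (@nat_of_ord K) (w j) == x) =
  count_tok n w x + (omap (@nat_of_ord K) y == x).
Proof.
move=> jn; rewrite /count_tok !(bigD1 (Ordinal jn) isT) /= {1}/set_at eqxx.
rewrite (eq_bigr (fun i : 'I_n => nat_of_bool (omap (@nat_of_ord K) (w i) == x))); first lia.
by move=> i; rewrite /set_at -val_eqE /= => /negbTE ->.
Qed.

Lemma count_pos n w x : 0 < count_tok n w x -> exists2 j, j < n & omap (@nat_of_ord K) (w j) = x.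
Proof.
rewrite /count_tok lt0n sum_nat_eq0 negb_forall => /existsP[i]; rewrite eqb0 negbK => /eqP H.
by exists i.
Qed.

Lemma count0 n w x i : count_tok n w x = 0 -> i < n -> omap (@nat_of_ord K) (w i) != x.
Proof.
by move/eqP; rewrite sum_nat_eq0 => /forallP H lin; have := H (Ordinal lin); rewrite eqb0.
Qed.

Lemma counts_set_at n w j y : j < n ->
  counts n (set_at w j y) = fun v => counts n w v + (omap (@nat_of_ord K) y == Some v)
                                     - (omap (@nat_of_ord K) (w j) == Some v).
Proof. by move=> jn; apply: functional_extensionality => v; rewrite /counts -(count_set_at w y _ jn) addnK. Qed.

Fixpoint sems (k : seq cmd) (s s' : nat -> nat) : Prop :=
  if k is c :: k then exists2 u, sem c s u & sems k u s' else s' = s.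

Lemma conf_step_sound n k w k' w' s : conf_step n (k, w) (k', w') ->
  sems k' (counts n w') s -> sems k (counts n w) s.
Proof.
case=> o /=; case: k => // -[v|v|v|c d|c] k /=.
- case/andP=> /eqP-> /eqP-> [j [jn al wj /= ->]] H; eexists; last exact: H.
  rewrite counts_set_at // wj; apply: functional_extensionality => u.
  rewrite /upd /= subn0 (inj_eq (@Some_inj _)) eq_sym.
  by case: eqP => [->|_]; rewrite ?addn1 ?addn0.
- case/andP=> /eqP-> /eqP-> [j [jn al wj /= wE]] H.
  exists (upd (counts n w) v (counts n w v).-1).
    split=> //; have := count_set_at w None (Some (nat_of_ord v)) jn.
    by rewrite wj /= eqxx addn0 addn1 /counts => <-.
  move: H; rewrite wE counts_set_at // wj; congr (sems _ _ _).
  apply: functional_extensionality => u.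
  rewrite /upd /= addn0 (inj_eq (@Some_inj _)) eq_sym.
  by case: eqP => [->|_]; rewrite ?subn1 ?subn0.
- case/andP=> /eqP-> /eqP-> [j [jn al wj /= ->]] H; exists (counts n w).
    split=> //; apply/eqP; rewrite sum_nat_eq0; apply/forallP=> i; rewrite eqb0.
    have := al i (ltn_ord i); rewrite /allowed /= !(inj_eq (@Some_inj _)).
    apply: contra => /eqP; case: (w i) => //= u [/ord_inj ->] //.
  by move: H; rewrite counts_set_at // wj; congr (sems _ _ _);
    apply: functional_extensionality => u /=; rewrite addnK.
- case/andP=> /eqP-> /eqP-> [j [jn al wj /= ->]] [u cu [u' du' ku']].
  exists u' => //; exists u => //; move: cu.
  by rewrite counts_set_at // wj; congr (sem _ _ _);
    apply: functional_extensionality => x /=; rewrite addnK.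
case/andP=> kE /eqP-> [j [jn al wj /= ->]].
have -> : counts n (set_at w j None) = counts n w.
  by rewrite counts_set_at // wj; apply: functional_extensionality => x; rewrite addnK.
case/orP: kE => /eqP-> => [H|[u cu [u' cu' ku']]]; first by exists (counts n w); [apply: rtc_refl|].
by exists u' => //; apply: rtc_step cu cu'.
Qed.

Lemma conf_run_sound n c c' : rtc (conf_step n) c c' -> c'.1 = [::] ->
  sems c.1 (counts n c.2) (counts n c'.2).
Proof.
elim=> [[k w] /= -> //|[k w] [k1 w1] {}c' stp _ IH /IH].
exact: conf_step_sound stp.
Qed.

Lemma set_at_id (w : nat -> token) j : set_at w j (w j) = w.
Proof. by apply: functional_extensionality => i; rewrite /set_at; case: eqP => [->|]. Qed.

Lemma idle_step n w f : 0 < count_tok n w None ->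
  (forall i, i < n -> allowed (None, None, f) (w i)) -> word_step n (None, None, f) w w.
Proof.
move=> /count_pos[j jn]; case wj : (w j) => [//|] _ al.
by exists j; split; rewrite //= -?wj ?set_at_id.
Qed.

(* T bounds the number of free cells used up. *)
Lemma sem_run c s s' : sem c s s' -> exists T, forall k n w,
  counts n w = s -> T < count_tok n w None ->
  exists w', [/\ rtc (conf_step n) (c :: k, w) (k, w'), counts n w' = s' &
                count_tok n w None <= count_tok n w' None + T].
Proof.
elim: c s s' => [v|v|v|c IHc d IHd|c IHc] s s'.
- move=> /= ->; exists 1 => k n w <- free; have [j jn] := count_pos (ltnW free).
  case wj : (w j) => [//|] _; exists (set_at w j (Some v)); split.
  + by apply: rtc1; exists (None, Some v, None); rewrite /= ?eqxx //; exists j.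
  + rewrite counts_set_at // wj; apply: functional_extensionality => u.
    rewrite /upd /= subn0 (inj_eq (@Some_inj _)) eq_sym.
    by case: eqP => [->|_]; rewrite ?addn1 ?addn0.
  by have := count_set_at w (Some v) None jn; rewrite wj /= addn0 => <-.
- move=> [] /= s_gt0 ->; exists 0 => k n w sE free.
  move: s_gt0; rewrite -sE => /count_pos[j jn].
  case wj : (w j) => [u|//] [/ord_inj uv]; subst u; exists (set_at w j None); split.
  + by apply: rtc1; exists (Some v, None, None); rewrite /= ?eqxx //; exists j.
  + rewrite counts_set_at // wj; apply: functional_extensionality => u.
    rewrite /upd /= addn0 (inj_eq (@Some_inj _)) eq_sym.
    by case: eqP => [->|_]; rewrite ?subn1 ?subn0.
  by have := count_set_at w None None jn; rewrite wj /= addn0 => ->; lia.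
- move=> [] /= sv0 ->; exists 0 => k n w sE free; exists w; split=> //; last by rewrite addn0.
  apply: rtc1; exists (None, None, Some (Some v)); rewrite /= ?eqxx //.
  apply: idle_step => // i lin; rewrite /allowed /= (inj_eq (@Some_inj _)) eq_sym.
  have := count0 (n := n) (w := w) (x := Some (nat_of_ord v)) _ lin.
  by rewrite -/(counts n w v) sE => /(_ sv0); case: (w i).
- case=> u /IHc[T1 H1] /IHd[T2 H2]; exists (T1 + T2) => k n w sE free.
  have [|w1 [run1 s1 free1]] := H1 (d :: k) n w sE; first by lia.
  have [|w2 [run2 s2 free2]] := H2 k n w1 s1; first by lia.
  exists w2; split=> //; last by lia.
  apply: rtc_step (rtc_trans run1 run2); exists (None, None, None); rewrite /= ?eqxx //.
  by apply: idle_step => //; lia.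
elim=> [{}s|{}s u {}s' /IHc[T1 H1] _ [T2 H2]].
  exists 0 => k n w sE free; exists w; split=> //; last by rewrite addn0.
  apply: rtc1; exists (None, None, None); rewrite /= ?eqxx //.
  by apply: idle_step.
exists (T1 + T2) => k n w sE free.
have [|w1 [run1 s1 free1]] := H1 (Star c :: k) n w sE; first by lia.
have [|w2 [run2 s2 free2]] := H2 k n w1 s1; first by lia.
exists w2; split=> //; last by lia.
apply: rtc_step (rtc_trans run1 run2); exists (None, None, None); rewrite /= ?eqxx ?orbT //.
by apply: idle_step => //; lia.
Qed.

(** * Tiles for a counter program *)

Section Compile.

Variables (R : nzRingType) (c : cmd) (v0 : 'I_K).

Definition states : seq (seq cmd) := [::] :: conts c [::].
Definition ctrl : finType := 'I_(size states).
Definition stack (q : ctrl) : seq cmd := nth [::] states q.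

Lemma final_lt : 0 < size states. Proof. by []. Qed.
Lemma start_lt : index [:: c] states < size states.
Proof. by rewrite index_mem inE conts_head orbT. Qed.

Definition edge : finType := (ctrl * op * ctrl)%type.
Definition esrc (e : edge) : ctrl := e.1.1.
Definition etgt (e : edge) : ctrl := e.2.
Definition efrom (e : edge) : token := e.1.2.1.1.
Definition eto (e : edge) : token := e.1.2.1.2.
(** Every triple is an edge, which keeps the type of edges finite by construction; a triple that is
    no transition is disabled by letting no cell accept it. *)
Definition eallowed (e : edge) (x : token) : bool :=
  cstep (stack e.1.1) e.1.2 (stack e.2) && allowed e.1.2 x.

Definition cmd_tiles := tile_set R esrc etgt efrom eto eallowed
  (Ordinal start_lt) (Ordinal final_lt) (Some v0) None.

Definition cmd_target z := target R ctrl token edge z.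

Definition run_step n := row_step esrc etgt efrom eto eallowed n.

Lemma run_step_conf n q w q' w' : run_step n (q, w) (q', w') ->
  conf_step n (stack q, w) (stack q', w').
Proof.
case=> -[[q1 o] q2] [j [jn [/= -> ->] al wj wE]].
have /andP[stp _] := al j jn; exists o => //; exists j; split=> // i /al.
by case/andP.
Qed.

Lemma conf_run_step n (q : ctrl) w k w' : conf_step n (stack q, w) (k, w') ->
  exists2 q' : ctrl, stack q' = k & run_step n (q, w) (q', w').
Proof.
case=> o /= stp [j [jn al wj wE]].
have kS : k \in states.
  have := mem_nth [::] (ltn_ord q); rewrite -/(stack q) inE => /predU1P[qE|qS].
    by rewrite qE in stp.
  exact: conts_closed qS stp.
have kl : index k states < size states by rewrite index_mem.
have kE : stack (Ordinal kl) = k by rewrite /stack /= nth_index.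
exists (Ordinal kl) => //; exists (q, o, Ordinal kl), j; split=> // i lin.
by rewrite /eallowed /= kE stp al.
Qed.

Lemma run_conf n s s' : rtc (run_step n) s s' ->
  rtc (conf_step n) (stack s.1, s.2) (stack s'.1, s'.2).
Proof.
elim=> [[q w]|[q w] [q1 w1] {}s' /run_step_conf stp _ IH]; first exact: rtc_refl.
exact: rtc_step stp IH.
Qed.

Lemma conf_run n s s' : rtc (conf_step n) s s' -> forall q : ctrl, stack q = s.1 ->
  exists2 q' : ctrl, stack q' = s'.1 & rtc (run_step n) (q, s.2) (q', s'.2).
Proof.
elim=> [{}s q qE|[k w] [k1 w1] {}s' stp _ IH q /= qE]; first by exists q => //; apply: rtc_refl.
rewrite -qE in stp; have [q1 q1E stp1] := conf_run_step stp.
by have [q' q'E run] := IH q1 q1E; exists q' => //; apply: rtc_step stp1 run.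
Qed.

Definition start_env (z : nat) : nat -> nat := fun v => if v == v0 then z.+1 else 0.

Lemma counts_init n z : z < n -> counts n (init_row (Some v0) None z) = start_env z.
Proof.
move=> zn; apply: functional_extensionality => v; rewrite /counts /count_tok /start_env.
rewrite -(subnKC zn) big_split_ord /= [X in _ + X]big1 => [|i _]; last first.
  by rewrite /init_row leqNgt ltnS leq_addr.
rewrite addn0 (eq_bigr (fun _ => nat_of_bool (v == v0))) => [|i _]; last first.
  by rewrite /init_row -ltnS ltn_ord /= (inj_eq (@Some_inj _)) eq_sym.
by rewrite sum_nat_const card_ord; case: eqP; rewrite ?muln1 ?muln0.
Qed.

Lemma free_init n z : z < n -> count_tok n (init_row (Some v0) None z) None = n - z.+1.
Proof.
have [m nE] : exists m, m = n - z.+1 by exists (n - z.+1).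
move=> zn; rewrite -nE -(subnKC zn) -nE /count_tok big_split_ord /= big1 => [|i _]; last first.
  by rewrite /init_row -ltnS ltn_ord.
rewrite add0n (eq_bigr (fun _ => 1)) => [|i _]; last first.
  by rewrite /init_row leqNgt ltnS leq_addr.
by rewrite sum1_card card_ord.
Qed.

Lemma cmd_tiles_nonzero f : f \in cmd_tiles -> nonzero_elt f.
Proof. exact: tile_set_nonzero. Qed.

Theorem subset_sum_cmd z :
  subset_sum cmd_tiles (cmd_target z) <-> exists s, sem c (start_env z) s.
Proof.
have startE : stack (Ordinal start_lt) = [:: c].
  by apply: nth_index; rewrite -index_mem; apply: start_lt.
rewrite /cmd_tiles subset_sum_run; split=> [[n [w [zn /run_conf]]]|[s /sem_run[T H]]].
  rewrite startE => /conf_run_sound /(_ erefl) [u].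
  rewrite counts_init; last by lia.
  by exists u.
(* This width leaves [T + 2] free cells next to the [z.+1] tokens, more than the bound [T] for the
   run. *)
pose n := z.+3 + T; have zn : z < n by rewrite /n; lia.
have [|w [run _ _]] := H [::] n _ (counts_init zn); first by rewrite free_init // /n; lia.
have [q' q'E {}run] := conf_run run startE.
exists n, w; split; first by rewrite /n; lia.
(* The run ends in some state whose stack is empty. By [conts_nil] the empty stack occurs in
   [states] at index 0 only, so that state is the final one. *)
suff -> : Ordinal final_lt = q' by [].
apply/val_inj => /=; case: q' q'E {run} => -[|m] //= ml; rewrite /stack /= => mE.
by have := mem_nth [::] ml; rewrite mE (negbTE (conts_nil _ _)).
Qed.

End Compile.

End Commands.

(** * Register machines as affine rules *)

(* (a, r, b, s) stands for the partial map a M + r |-> b M + s. *)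
Definition rule := (nat * nat * nat * nat)%type.

Definition rule_step (rs : seq rule) (x y : nat) : Prop :=
  exists a r b s M, [/\ (a, r, b, s) \in rs, x = a * M + r & y = b * M + s].

Fixpoint nth_prime (k : nat) : nat :=
  if k is k'.+1 then s2val (prime_above (nth_prime k')) else 2.

Arguments nth_prime : simpl never.

Lemma nth_prime_prime k : prime (nth_prime k).
Proof. by case: k => [|k] //; rewrite /nth_prime -/nth_prime; case: prime_above. Qed.

Lemma nth_prime_inj : injective nth_prime.
Proof.
have lt k : nth_prime k < nth_prime k.+1 by rewrite [nth_prime k.+1]/nth_prime -/nth_prime; case: prime_above.
have mono := homo_ltn ltn_trans lt.
by move=> i j; case: (ltngtP i j) => // /mono; rewrite ltn_neqAle => /andP[/eqP H _] // /esym.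
Qed.

(** Even and odd indices keep the primes of registers and of program counters apart. Register 0 gets
    the prime 2, so the initial code is [pc_prime 0 * 2 ^ n], and output 0 shows as an odd cofactor
    of the counter prime. *)
Definition reg_prime r := nth_prime r.*2.
Definition pc_prime i := nth_prime i.*2.+1.

Lemma reg_prime_prime r : prime (reg_prime r). Proof. exact: nth_prime_prime. Qed.
Lemma pc_prime_prime i : prime (pc_prime i). Proof. exact: nth_prime_prime. Qed.
Lemma reg_prime_inj : injective reg_prime.
Proof. by move=> r s /nth_prime_inj/double_inj. Qed.
Lemma pc_prime_inj : injective pc_prime.
Proof. by move=> i j /nth_prime_inj[/double_inj]. Qed.
Lemma pc_reg_prime i r : pc_prime i != reg_prime r.
Proof.
apply/eqP=> /nth_prime_inj/(congr1 odd); by rewrite /= !odd_double.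
Qed.

Opaque reg_prime pc_prime.

Definition regs_code B (f : nat -> nat) := \prod_(r < B) reg_prime r ^ f r.
Definition conf_code B (s : mstate) := pc_prime s.1 * regs_code B s.2.

Lemma regs_code_gt0 B f : 0 < regs_code B f.
Proof. by apply: prodn_gt0 => r; rewrite expn_gt0 prime_gt0 ?reg_prime_prime. Qed.

Lemma conf_code_gt0 B s : 0 < conf_code B s.
Proof. by rewrite muln_gt0 regs_code_gt0 prime_gt0 ?pc_prime_prime. Qed.

Lemma regs_code_upd B f r v : r < B ->
  regs_code B (upd f r v) * reg_prime r ^ f r = regs_code B f * reg_prime r ^ v.
Proof.
move=> rB; rewrite /regs_code !(bigD1 (Ordinal rB) isT) /= {1}/upd eqxx.
rewrite (eq_bigr (fun i : 'I_B => reg_prime i ^ f i)) => [|i ir].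
  by rewrite mulnC -mulnA [_ * reg_prime r ^ v]mulnC.
by rewrite /upd; move: ir; rewrite -val_eqE /= => /negbTE ->.
Qed.

Lemma regs_code_inc B f r : r < B ->
  regs_code B (upd f r (f r).+1) = reg_prime r * regs_code B f.
Proof.
move=> rB; apply/eqP.
rewrite -(eqn_pmul2r (_ : 0 < reg_prime r ^ f r)); last by rewrite expn_gt0 prime_gt0 ?reg_prime_prime.
by rewrite regs_code_upd // expnS mulnCA mulnA.
Qed.

Lemma prime_dvd_regs B f p : prime p -> p %| regs_code B f ->
  exists2 r, r < B & p = reg_prime r /\ 0 < f r.
Proof.
move=> pp; rewrite /regs_code; elim/big_rec: _ => [|r x _ IH].
  by rewrite dvdn1 => /eqP p1; rewrite p1 in pp.
rewrite Euclid_dvdM // => /orP[|//]; rewrite Euclid_dvdX // dvdn_prime2 ?reg_prime_prime //.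
by move=> /andP[/eqP pE fr]; exists r.
Qed.

Lemma pc_dvd B i s : pc_prime i %| conf_code B s -> i = s.1.
Proof.
rewrite Euclid_dvdM ?pc_prime_prime // dvdn_prime2 ?pc_prime_prime // => /orP[/eqP/pc_prime_inj //|].
move/(prime_dvd_regs (pc_prime_prime i)) => [r _ [/eqP]].
by rewrite (negbTE (pc_reg_prime _ _)).
Qed.

(** * Simulation of a register machine by affine rules *)

Definition fetch (p : prog) i : option instr := nth None (map Some p) i.

(** Halting sends [pc_prime i] times an odd number to 0. A decrement divides by the register prime;
    its zero branch needs one rule for each nonzero residue [rho], since non-divisibility is not a
    single affine condition. *)
Definition instr_rules i (o : option instr) : seq rule :=
  match o with
  | None => [:: (2 * pc_prime i, pc_prime i, 0, 0)]
  | Some (INC r) => [:: (pc_prime i, 0, pc_prime i.+1 * reg_prime r, 0)]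
  | Some (DEC r j) => (pc_prime i * reg_prime r, 0, pc_prime i.+1, 0) ::
      [seq (pc_prime i * reg_prime r, pc_prime i * rho, pc_prime j * reg_prime r, pc_prime j * rho)
        | rho <- iota 1 (reg_prime r).-1]
  end.

Definition rules (p : prog) B : seq rule :=
  flatten [seq instr_rules i (fetch p i) | i <- iota 0 B].

Definition instr_bound B (ins : instr) : bool :=
  match ins with INC r => r < B | DEC r j => (r < B) && (j < B) end.

Definition prog_bound B (p : prog) : bool := (size p < B) && all (instr_bound B) p.

Lemma prog_boundP p : exists B, prog_bound B p.
Proof.
elim: p => [|ins p [B /andP[sB aB]]]; first by exists 1.
pose m := match ins with INC r => r | DEC r j => maxn r j end.
exists (maxn B m).+1; apply/andP; split; first by rewrite /=; lia.
rewrite /=; apply/andP; split; first by rewrite /m; case: (ins) => [r|r j] /=; lia.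
apply: sub_all aB => -[r|r j] /=; lia.
Qed.

Lemma rule_in p B i ru : i < B -> ru \in instr_rules i (fetch p i) -> ru \in rules p B.
Proof.
move=> iB H; apply/flattenP; exists (instr_rules i (fetch p i)) => //.
by apply/mapP; exists i; rewrite // mem_iota.
Qed.

Lemma rule_inv p B ru : ru \in rules p B -> exists2 i, i < B & ru \in instr_rules i (fetch p i).
Proof. by case/flattenP=> l /mapP[i]; rewrite mem_iota add0n => /= iB -> H; exists i. Qed.

Lemma fetch_bound p B i ins : prog_bound B p -> fetch p i = Some ins ->
  i.+1 < B /\ instr_bound B ins.
Proof.
case/andP=> sB aB; rewrite /fetch; case: (ltnP i (size p)) => ip.
  rewrite (nth_map ins) // => -[<-]; split; first by apply: leq_ltn_trans sB.
  exact: (all_nthP ins aB i ip).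
by rewrite nth_default // size_map.
Qed.

Lemma step_fetch p pc f : step p (pc, f) =
  match fetch p pc with
  | None => None
  | Some (INC r) => Some (pc.+1, upd f r (f r).+1)
  | Some (DEC r j) => if f r is n.+1 then Some (pc.+1, upd f r n) else Some (j, f)
  end.
Proof. by []. Qed.

Lemma dvdn_regs_inc B f r : r < B -> (reg_prime r %| regs_code B f) = (0 < f r).
Proof.
move=> rB; apply/idP/idP=> [/(prime_dvd_regs (reg_prime_prime r))[r' _ [/reg_prime_inj -> //]]|fr].
have -> : f = upd (upd f r (f r).-1) r (upd f r (f r).-1 r).+1.
  apply: functional_extensionality => x; rewrite /upd eqxx.
  by case: eqP => [->|] //; rewrite prednK.
by rewrite regs_code_inc // dvdn_mulr.
Qed.

Lemma regs_code_dec B f r n : r < B -> f r = n.+1 ->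
  regs_code B f = reg_prime r * regs_code B (upd f r n).
Proof.
move=> rB fr; rewrite -{1}(_ : upd (upd f r n) r (upd f r n r).+1 = f) ?regs_code_inc //.
by apply: functional_extensionality => x; rewrite /upd eqxx; case: eqP => [->|].
Qed.

Lemma sim_step p B s s' : prog_bound B p -> step p s = Some s' ->
  rule_step (rules p B) (conf_code B s) (conf_code B s') /\ s'.1 < B.
Proof.
case: s => pc f pB; rewrite step_fetch; case E : (fetch p pc) => [[r|r j]|] //.
  have [pcB /= rB] := fetch_bound pB E; case=> <-; split=> //.
  exists (pc_prime pc), 0, (pc_prime pc.+1 * reg_prime r), 0, (regs_code B f).
  split; rewrite ?addn0 //; last by rewrite /conf_code /= regs_code_inc // mulnA.
  by apply: (rule_in (i := pc)); rewrite ?E ?inE //; apply: ltnW.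
have [pcB /= /andP[rB jB]] := fetch_bound pB E; case Ef : (f r) => [|n] [<-]; split=> //; last first.
  exists (pc_prime pc * reg_prime r), 0, (pc_prime pc.+1), 0, (regs_code B (upd f r n)).
  split; rewrite ?addn0 //; last by rewrite /conf_code /= (regs_code_dec rB Ef) mulnA.
  by apply: (rule_in (i := pc)); rewrite ?E ?inE ?eqxx //; apply: ltnW.
(* The register is empty, so [q] does not divide [g]: the rule is that of the residue [g %% q],
   applied with [M] the quotient. *)
pose g := regs_code B f; pose q := reg_prime r.
have gE : g = q * (g %/ q) + g %% q by rewrite [q * _]mulnC -divn_eq.
exists (pc_prime pc * q), (pc_prime pc * (g %% q)), (pc_prime j * q), (pc_prime j * (g %% q)), (g %/ q).
split; rewrite -?mulnA -?mulnDr -?gE //.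
apply: (rule_in (i := pc)); rewrite ?E ?inE ?(ltnW pcB) //=; apply/orP; right.
apply/mapP; exists (g %% q) => //; rewrite mem_iota add1n (prednK (prime_gt0 (reg_prime_prime r))).
by rewrite ltn_mod (prime_gt0 (reg_prime_prime r)) andbT lt0n -/(dvdn q g) dvdn_regs_inc // Ef.
Qed.

Lemma sim_halt p B s : s.1 < B -> 0 < B -> step p s = None -> s.2 0 = 0 ->
  rule_step (rules p B) (conf_code B s) 0.
Proof.
case: s => pc f pcB B0; rewrite step_fetch; case E : (fetch p pc) => [[r|r j]|] //.
  by case: (f r).
move=> _ /= f0; pose g := regs_code B f.
have : ~~ (2 %| g) by rewrite (_ : 2 = reg_prime 0) // dvdn_regs_inc // f0.
rewrite dvdn2 negbK => og.
exists (2 * pc_prime pc), (pc_prime pc), 0, 0, g./2; split=> //.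
  by apply: (rule_in (i := pc)); rewrite ?E ?inE.
rewrite /conf_code /= -/g -[X in _ * X = _]odd_double_half og -muln2.
by rewrite mulnDr muln1 addnC [2 * _]mulnC -mulnA [2 * _]mulnC.
Qed.

(** Every left side is a multiple of [pc_prime i], and the only counter prime dividing the code of a
    configuration is its own. So only the rules of the current instruction apply, and divisibility
    by the register prime tells which of them. *)
Lemma sim_inv p B s y : prog_bound B p -> rule_step (rules p B) (conf_code B s) y ->
  (exists2 s', step p s = Some s' & y = conf_code B s') \/
  [/\ step p s = None, s.2 0 = 0 & y = 0].
Proof.
case: s => pc f pB [a [b [c [d [M [/rule_inv[i iB iR] xE ->]]]]]].
have B0 : 0 < B by apply: leq_ltn_trans iB.
have P0 : 0 < pc_prime i by rewrite prime_gt0 ?pc_prime_prime.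
have ipc : i = pc.
  apply: (@pc_dvd B i (pc, f)); rewrite xE; move: iR; case: (fetch p i) => [[r|r j]|] /=.
  - by rewrite inE => /eqP[-> -> _ _]; rewrite addn0 dvdn_mulr.
  - rewrite inE => /predU1P[[-> -> _ _]|/mapP[rho _ [-> -> _ _]]].
      by rewrite addn0 -mulnA dvdn_mulr.
    by rewrite -mulnA -mulnDr dvdn_mulr.
  by rewrite inE => /eqP[-> -> _ _]; rewrite -mulnA mulnCA addnC -mulnS dvdn_mulr.
subst i; rewrite step_fetch; move: iR; case E : (fetch p pc) => [[r|r j]|] /=.
- have [_ /= rB] := fetch_bound pB E; rewrite inE => /eqP[aE bE cE dE]; subst a b c d.
  move/eqP: xE; rewrite addn0 eqn_pmul2l // => /eqP <-; left; eexists; first by [].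
  by rewrite addn0 /conf_code /= regs_code_inc // mulnA.
- have [_ /= /andP[rB jB]] := fetch_bound pB E.
  have q0 : 0 < reg_prime r by rewrite prime_gt0 ?reg_prime_prime.
  rewrite inE => /predU1P[[aE bE cE dE]|/mapP[rho rhoI [aE bE cE dE]]]; subst a b c d; left.
    move/eqP: xE; rewrite addn0 -mulnA eqn_pmul2l //= => /eqP gE.
    have : 0 < f r by rewrite -(dvdn_regs_inc f rB) gE dvdn_mulr.
    case Ef : (f r) => [//|n] _; eexists; first by [].
    move/eqP: gE; rewrite (regs_code_dec rB Ef) eqn_pmul2l // => /eqP <-.
    by rewrite addn0.
  move/eqP: xE; rewrite -!mulnA -!mulnDr eqn_pmul2l //= => /eqP gE.
  move: rhoI; rewrite mem_iota add1n prednK // => /andP[rho0 rhoq].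
  have : ~~ (0 < f r).
    rewrite -(dvdn_regs_inc f rB) gE /dvdn mulnC modnMDl modn_small //.
    by rewrite -lt0n.
  case: (f r) => [|//] _; eexists; first by [].
  by rewrite /conf_code /= gE.
rewrite inE => /eqP[aE bE cE dE]; subst a b c d; right; split=> //.
have gE : regs_code B f = M.*2.+1.
  move: xE; rewrite /conf_code /= => xE; apply/eqP; rewrite -(eqn_pmul2l P0) xE -muln2 mulnS addnC.
  by rewrite [2 * _]mulnC -mulnA [2 * M]mulnC.
apply/eqP; rewrite eqn0Ngt -(dvdn_regs_inc f B0) gE.
by rewrite (_ : reg_prime 0 = 2) // dvdn2 /= odd_double.
Qed.

(** Codes of configurations are positive, so 0 is reached only through a halting rule. *)
Lemma sim_halts p B n : prog_bound B p ->
  rtc (rule_step (rules p B)) (conf_code B (init n)) 0 <-> halts_with p n 0.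
Proof.
move=> pB; have B0 : 0 < B by case/andP: pB => /(leq_trans _)->.
rewrite /halts_with; have : (init n).1 < B by [].
move: (init n) => s0 sB; split.
  move xE : (conf_code B s0) => x; move yE : 0 => y run.
  elim: run s0 xE yE {sB} => [{}x s0 xE x0|{}x z {}y stp _ IH s0 xE yE].
    by have := conf_code_gt0 B s0; rewrite xE -x0.
  subst x y; case: (sim_inv pB stp) => [[s' s0s' zE]|[s0N s00 _]].
    by have [fuel [s [run sE]]] := IH s' (esym zE) erefl; exists fuel.+1, s; rewrite /= s0s'.
  by exists 1, s0; rewrite /= s0N.
case=> fuel [s []]; elim: fuel s0 sB => //= fuel IH s0 sB.
case E : (step p s0) => [s1|] => [run s0E|[<-] s0E]; last exact/rtc1/sim_halt.
have [stp s1B] := sim_step pB E; apply: rtc_step stp _; exact: IH.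
Qed.

(** * Deterministic loop programs *)

(** Serves to evaluate [Star] of a command whose steps stay in a family of states parametrised by
    [f]. *)
Lemma rtc_image (A T : Type) (f : A -> T) (r : A -> A -> Prop) (R : T -> T -> Prop) :
  (forall x t, R (f x) t <-> exists2 y, r x y & t = f y) ->
  forall x t, rtc R (f x) t <-> exists2 y, rtc r x y & t = f y.
Proof.
move=> H x t; split=> [|[y ry ->]].
  move fxE : (f x) => u run; elim: run x fxE => [{}u x <-|{}u v {}t uv _ IH x xu].
    by exists x => //; apply: rtc_refl.
  subst u; have [y rxy vE] := (H _ _).1 uv; have [y' ry' tE] := IH y (esym vE).
  by exists y' => //; apply: rtc_step rxy ry'.
elim: ry => [{}x|{}x {}y z rxy _ IH]; first exact: rtc_refl.
by apply: rtc_step IH; apply/H; exists y.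
Qed.

Section Loops.

Variable K' : nat.
Notation K := K'.+1.

Inductive loop := LSkip | LInc of 'I_K | LSeq of loop & loop | LFor of 'I_K & loop.

Fixpoint ev (p : loop) (s : nat -> nat) : nat -> nat :=
  match p with
  | LSkip => s
  | LInc v => upd s v (s v).+1
  | LSeq p q => ev q (ev p s)
  | LFor v p => upd (iter (s v) (ev p) s) v 0
  end.

Fixpoint occurs (v : 'I_K) (p : loop) : bool :=
  match p with
  | LSkip => false
  | LInc w => v == w
  | LSeq p q => occurs v p || occurs v q
  | LFor w p => (v == w) || occurs v p
  end.

(* Then the body runs exactly as often as the initial value of the counter says. *)
Fixpoint wf (p : loop) : bool :=
  match p with
  | LSkip | LInc _ => true
  | LSeq p q => wf p && wf q
  | LFor v p => ~~ occurs v p && wf p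
  end.

(* [Star (Zero ord0)] is the identity relation *)
Fixpoint compile (p : loop) : cmd K :=
  match p with
  | LSkip => Star (Zero ord0)
  | LInc v => Inc v
  | LSeq p q => Seq (compile p) (compile q)
  | LFor v p => Seq (Star (Seq (Dec v) (compile p))) (Zero v)
  end.

Lemma upd_upd s r v v' : upd (upd s r v) r v' = upd s r v'.
Proof. by apply: functional_extensionality => x; rewrite /upd; case: eqP. Qed.

Lemma upd_comm s r v r' v' : r != r' -> upd (upd s r v) r' v' = upd (upd s r' v') r v.
Proof.
move=> rr; apply: functional_extensionality => x; rewrite /upd.
by case: eqP => // ->; rewrite eq_sym (negbTE rr).
Qed.

Lemma upd_id s r : upd s r (s r) = s.
Proof. by apply: functional_extensionality => x; rewrite /upd; case: eqP => [->|]. Qed.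

Lemma upd_same s r x : s r = x -> upd s r x = s.
Proof. by move=> <-; apply: upd_id. Qed.

Lemma upd_eq s r v : upd s r v r = v. Proof. by rewrite /upd eqxx. Qed.

Lemma upd_neq s r v r' : r' != r -> upd s r v r' = s r'.
Proof. by rewrite /upd => /negbTE ->. Qed.

Lemma ev_upd p (v : 'I_K) s x : ~~ occurs v p -> ev p (upd s v x) = upd (ev p s) v x.
Proof.
elim: p s => [|w|p IHp q IHq|w p IH] s //=; rewrite ?negb_or.
- by rewrite -val_eqE => /= vw; rewrite upd_neq 1?eq_sym // upd_comm.
- by case/andP=> vp vq; rewrite IHp // IHq.
rewrite -val_eqE => /= /andP[vw vp]; have wv : (w : nat) != v by rewrite eq_sym.
rewrite upd_neq // [in RHS]upd_comm //; congr (upd _ _ _).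
by elim: (s w) => //= n ->; rewrite IH.
Qed.

Lemma ev_frame p (v : 'I_K) s : ~~ occurs v p -> ev p s v = s v.
Proof. by move=> vp; rewrite -{1}(upd_id s v) ev_upd // upd_eq. Qed.

Lemma compileP p s s' : wf p -> sem (compile p) s s' <-> s' = ev p s.
Proof.
elim: p s s' => [|v|p IHp q IHq|v p IH] s s' //=.
- move=> _; split=> [|->]; last exact: rtc_refl.
  by elim=> // {}s u {}s' [_ ->] _.
- case/andP=> wp wq; split=> [[u /(IHp _ _ wp) -> /(IHq _ _ wq) //]|->].
  by exists (ev p s); [apply/IHp|apply/IHq].
(* [Star] guesses the number of rounds and the closing [Zero v] accepts the right guess only. [F],
   the outcome of the whole loop, is invariant under one round, so it can be followed along the
   run. *)
case/andP=> vp wp; pose F (s : nat -> nat) := upd (iter (s v) (ev p) s) v 0.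
have iter_upd n x u : iter n (ev p) (upd u v x) = upd (iter n (ev p) u) v x.
  by elim: n => //= n ->; rewrite ev_upd.
have Fstep (u : nat -> nat) : 0 < u v -> F (ev p (upd u v (u v).-1)) = F u.
  case E : (u v) => [//|n] _; rewrite /F [ev p _ v]ev_frame // upd_eq E /=.
  by rewrite -iterSr iter_upd upd_upd.
split=> [[u run [uv ->]]|->].
  rewrite -/(F s); suff -> : F s = F u by rewrite /F uv /= -uv upd_id.
  elim: run {uv} => // {}s t {}u [t' [sv ->] /(IH _ _ wp) ->] _ <-.
  by rewrite Fstep.
exists (F s); last by rewrite /F upd_eq.
move E : (s v) => n; elim: n s E => [|n IHn] s E.
  have -> : F s = s by rewrite /F E /= -E upd_id.
  exact: rtc_refl.
rewrite -Fstep ?E //; apply: rtc_step (IHn _ _); last by rewrite ev_frame // upd_eq.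
by exists (upd s v n); [rewrite E|apply/IH].
Qed.

Lemma sem_seq_compile p c s s' : wf p -> sem (Seq (compile p) c) s s' <-> sem c (ev p s) s'.
Proof.
move=> wp; split=> [[u /(compileP _ _ wp) -> //]|H].
by exists (ev p s) => //; apply/compileP.
Qed.

Definition incs (rs : seq 'I_K) : loop := foldr (fun v => LSeq (LInc v)) LSkip rs.

Lemma wf_incs rs : wf (incs rs). Proof. by elim: rs. Qed.

Definition occ (rs : seq 'I_K) (x : nat) : nat := count_mem x (map (@nat_of_ord K) rs).

Lemma ev_incs rs s x : ev (incs rs) s x = s x + occ rs x.
Proof.
rewrite /occ; elim: rs s => [|v rs IH] s /=; first by rewrite addn0.
by rewrite IH /upd eq_sym; case: eqP => [->|_]; rewrite ?addSnnS.
Qed.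

Lemma iter_incs n rs s x : iter n (ev (incs rs)) s x = s x + n * occ rs x.
Proof. by elim: n => [|n IH] /=; rewrite ?addn0 // ev_incs IH -addnA mulSn [occ _ _ + _]addnC. Qed.

(** Several targets copy [v], repeated ones multiply it, and the empty list clears it. *)
Definition move v rs := LFor v (incs rs).

Lemma ev_move v rs s x : ev (move v rs) s x = if x == v then 0 else s x + s v * occ rs x.
Proof. by rewrite /= /upd; case: eqP => // _; rewrite iter_incs. Qed.

(** This is how a program guesses a number [m]. *)
Lemma star_incs rs s s' : sem (Star (compile (incs rs))) s s' <->
  exists m, s' = fun x => s x + m * occ rs x.
Proof.
have evE u : ev (incs rs) u = fun x => u x + occ rs x.
  by apply: functional_extensionality => x; apply: ev_incs.
split=> [|[m ->]] /=.
  elim=> [u|u t u' /(compileP _ _ (wf_incs rs)) -> _ [m ->]].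
    by exists 0; apply: functional_extensionality => x; rewrite addn0.
  by exists m.+1; apply: functional_extensionality => x; rewrite evE mulSn addnA.
elim: m s => [|m IH] s.
  rewrite (_ : (fun x => _) = s); first exact: rtc_refl.
  by apply: functional_extensionality => x; rewrite addn0.
apply: rtc_step (_ : rtc _ (ev (incs rs) s) _); first by apply/compileP; rewrite ?wf_incs.
rewrite (_ : (fun x => _) = fun x => ev (incs rs) s x + m * occ rs x) //.
by apply: functional_extensionality => x; rewrite evE mulSn addnA.
Qed.

(** An equality test that empties both counters; it turns guesses into checked guesses. *)
Definition equalize (v w : 'I_K) : cmd K := Seq (Star (Seq (Dec v) (Dec w))) (Seq (Zero v) (Zero w)).

Lemma equalizeP v w s s' : v != w ->
  sem (equalize v w) s s' <-> s v = s w /\ s' = upd (upd s v 0) w 0.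
Proof.
rewrite -val_eqE /= => vw; have wv : (w : nat) != v by rewrite eq_sym.
split=> [[u run [u' [uv ->] [uw ->]]]|[]].
  elim: run uv uw => [{}s sv sw|{}s t {}u [t' [sv ->] [tw ->]] _ IH uv uw].
    by rewrite sv sw; split=> //; rewrite (upd_same sv) (upd_same sw).
  have [tE ->] := IH uv uw; move: tE tw.
  rewrite !upd_eq !(upd_neq _ _ wv) !(upd_neq _ _ vw) upd_eq => tE tw; split; first by lia.
  by rewrite [upd (upd (upd s v _) w _) v 0]upd_comm ?upd_upd // upd_upd.
move E : (s v) => n; elim: n s E => [|n IH] s sv sw s'E.
  exists s; first exact: rtc_refl.
  by exists s; split=> //; rewrite s'E (upd_same sv) (upd_same (esym sw)).
have [|||u run H] := IH (upd (upd s v n) w n).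
- by rewrite upd_neq // upd_eq.
- by rewrite upd_eq.
- by rewrite s'E [upd (upd (upd s v _) w _) v 0]upd_comm ?upd_upd // upd_upd.
exists u => //; apply: rtc_step run.
exists (upd s v n); first by rewrite sv.
by rewrite upd_neq // -sw.
Qed.

End Loops.

(** * The universal program *)

Definition env (l : seq nat) : nat -> nat := nth 0 l.

(** Effects on explicit lists of register values, so that evaluation leaves one arithmetic identity
    per register. *)
Definition add_at K' (rs : seq 'I_K'.+1) c l :=
  mkseq (fun x => nth 0 l x + c * occ rs x) K'.+1.

Definition move_at K' (v : 'I_K'.+1) (rs : seq 'I_K'.+1) l :=
  mkseq (fun x => if x == v then 0 else nth 0 l x + nth 0 l v * occ rs x) K'.+1.

Lemma occ_out K' (rs : seq 'I_K'.+1) x : K'.+1 <= x -> occ rs x = 0.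
Proof.
move=> Kx; apply/count_memPn/mapP=> -[v _ xv].
by have := ltn_ord v; rewrite ltnNge -xv Kx.
Qed.

Lemma occ_nseq K' (v : 'I_K'.+1) k x : occ (nseq k v) x = (v == x :> nat) * k.
Proof. by rewrite /occ map_nseq count_nseq. Qed.

Lemma add_env K' (rs : seq 'I_K'.+1) c l : size l <= K'.+1 ->
  (fun x => env l x + c * occ rs x) = env (add_at rs c l).
Proof.
move=> sl; apply: functional_extensionality => x; rewrite /env /add_at.
have [xK|Kx] := ltnP x K'.+1; first by rewrite nth_mkseq.
by rewrite occ_out // muln0 !nth_default // ?size_mkseq // (leq_trans sl).
Qed.

Lemma incs_env K' (rs : seq 'I_K'.+1) l : size l <= K'.+1 ->
  ev (incs rs) (env l) = env (add_at rs 1 l).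
Proof.
move=> sl; rewrite -add_env //; apply: functional_extensionality => x.
by rewrite ev_incs mul1n.
Qed.

Lemma star_env K' (rs : seq 'I_K'.+1) l s' : size l <= K'.+1 ->
  sem (Star (compile (incs rs))) (env l) s' <-> exists m, s' = env (add_at rs m l).
Proof.
by move=> sl; rewrite star_incs; split=> -[m ->]; exists m; rewrite ?add_env // -add_env.
Qed.

Lemma move_env K' (v : 'I_K'.+1) (rs : seq 'I_K'.+1) l : size l <= K'.+1 ->
  ev (move v rs) (env l) = env (move_at v rs l).
Proof.
move=> sl; apply: functional_extensionality => x; rewrite ev_move /env /move_at.
have [xK|Kx] := ltnP x K'.+1; first by rewrite nth_mkseq.
have lx := leq_trans sl Kx.
by rewrite occ_out // muln0 addn0 [nth 0 l x]nth_default // nth_default ?size_mkseq // if_same.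
Qed.

Lemma upd_env l v x : upd (env l) v x = env (set_nth 0 l v x).
Proof. by apply: functional_extensionality => y; rewrite /upd /env nth_set_nth. Qed.

Lemma env_pad k l : env (l ++ nseq k 0) = env l.
Proof.
apply: functional_extensionality => x; rewrite /env nth_cat.
by case: ltnP => // lx; rewrite nth_nseq if_same nth_default.
Qed.

Ltac list_eq := rewrite /add_at /move_at /mkseq /= /occ /= ?(addn0, add0n, muln0, muln1, mul1n); congr env;
  repeat (apply: (congr2 cons); [by lia|]); try reflexivity.

(* Registers: z the program, N the configuration, n the input of the simulated machine. *)
Local Notation rz := (@Ordinal 14 0 isT).
Local Notation rN := (@Ordinal 14 1 isT).
Local Notation rw := (@Ordinal 14 2 isT).
Local Notation ra := (@Ordinal 14 3 isT).
Local Notation rr := (@Ordinal 14 4 isT).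
Local Notation rb := (@Ordinal 14 5 isT).
Local Notation rs := (@Ordinal 14 6 isT).
Local Notation rx := (@Ordinal 14 7 isT).
Local Notation ry := (@Ordinal 14 8 isT).
Local Notation rt := (@Ordinal 14 9 isT).
Local Notation ru := (@Ordinal 14 10 isT).
Local Notation ri := (@Ordinal 14 11 isT).
Local Notation rj := (@Ordinal 14 12 isT).
Local Notation rn := (@Ordinal 14 13 isT).

Local Notation "p ;; q" := (LSeq p q) (at level 61, right associativity).

(** Adds 1 + 2 + ... + [u] to [ry]: [ri] counts the rounds and is restored through [rj] after each
    copy. *)
Definition tri_loop : loop 13 :=
  LFor ru (incs [:: ri] ;; move ri [:: ry; rj] ;; move rj [:: ri]) ;; move ri [::].

Lemma tri_S m : (m.+1 * m.+2)./2 = (m * m.+1)./2 + m.+1.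
Proof. by rewrite !mulnS; lia. Qed.

Lemma tri_loopE z N w a r b s x y t u n :
  ev tri_loop (env [:: z; N; w; a; r; b; s; x; y; t; u; 0; 0; n]) =
  env [:: z; N; w; a; r; b; s; x; y + (u * u.+1)./2; t; 0; 0; 0; n].
Proof.
set body := incs [:: ri] ;; move ri [:: ry; rj] ;; move rj [:: ri].
have bodyE y' i : ev body (env [:: z; N; w; a; r; b; s; x; y'; t; u; i; 0; n]) =
    env [:: z; N; w; a; r; b; s; x; y' + i.+1; t; u; i.+1; 0; n].
  rewrite (_ : ev body _ = ev (move rj [:: ri]) (ev (move ri [:: ry; rj]) (ev (incs [:: ri])
    (env [:: z; N; w; a; r; b; s; x; y'; t; u; i; 0; n])))) //.
  by rewrite incs_env // !move_env ?size_mkseq //; list_eq.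
have iterE m : iter m (ev body) (env [:: z; N; w; a; r; b; s; x; y; t; u; 0; 0; n]) =
    env [:: z; N; w; a; r; b; s; x; y + (m * m.+1)./2; t; u; m; 0; n].
  elim: m => [|m IH]; first by rewrite /= addn0.
  by rewrite iterS IH bodyE -addnA -tri_S.
rewrite (_ : ev tri_loop _ = ev (move ri [::]) (upd (iter u (ev body)
  (env [:: z; N; w; a; r; b; s; x; y; t; u; 0; 0; n])) ru 0)) //.
by rewrite iterE upd_env move_env //; list_eq.
Qed.

(** Pairs [ry] with a constant: the triangular number of [ry + k], plus [k]. *)
Definition pair_loop k : loop 13 :=
  move ry [:: ru] ;; incs (nseq k ru) ;; tri_loop ;; incs (nseq k ry).

Lemma pair_loopE k z N w a r b s x y t n :
  ev (pair_loop k) (env [:: z; N; w; a; r; b; s; x; y; t; 0; 0; 0; n]) =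
  env [:: z; N; w; a; r; b; s; x; npair y k; t; 0; 0; 0; n].
Proof.
rewrite (_ : ev _ _ = ev (incs (nseq k ry)) (ev tri_loop (ev (incs (nseq k ru)) (ev (move ry [:: ru])
  (env [:: z; N; w; a; r; b; s; x; y; t; 0; 0; 0; n]))))) //.
rewrite move_env // incs_env ?size_mkseq //.
rewrite (_ : env (add_at _ _ _) = env [:: z; N; w; a; r; b; s; x; 0; t; y + k; 0; 0; n]); last first.
  by rewrite /add_at /move_at /mkseq /= !occ_nseq; list_eq.
rewrite tri_loopE incs_env // /npair.
by rewrite /add_at /mkseq /= !occ_nseq; list_eq.
Qed.

Definition power_loop : loop 13 :=
  LFor rn (move rN [:: ry; ry] ;; move ry [:: rN]).

Lemma power_loopE z N n :
  ev power_loop (env [:: z; N; 0; 0; 0; 0; 0; 0; 0; 0; 0; 0; 0; n]) =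
  env [:: z; N * 2 ^ n; 0; 0; 0; 0; 0; 0; 0; 0; 0; 0; 0; 0].
Proof.
set body := (move rN [:: ry; ry] ;; move ry [:: rN]).
have bodyE N' : ev body (env [:: z; N'; 0; 0; 0; 0; 0; 0; 0; 0; 0; 0; 0; n]) =
    env [:: z; N' * 2; 0; 0; 0; 0; 0; 0; 0; 0; 0; 0; 0; n].
  rewrite (_ : ev body _ = ev (move ry [:: rN]) (ev (move rN [:: ry; ry])
    (env [:: z; N'; 0; 0; 0; 0; 0; 0; 0; 0; 0; 0; 0; n]))) //.
  by rewrite !move_env ?size_mkseq //; list_eq.
have iterE m : iter m (ev body) (env [:: z; N; 0; 0; 0; 0; 0; 0; 0; 0; 0; 0; 0; n]) =
    env [:: z; N * 2 ^ m; 0; 0; 0; 0; 0; 0; 0; 0; 0; 0; 0; n].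
  elim: m => [|m IH]; first by rewrite /= muln1.
  by rewrite iterS IH bodyE -mulnA -expnSr.
rewrite (_ : ev power_loop _ = upd (iter n (ev body)
  (env [:: z; N; 0; 0; 0; 0; 0; 0; 0; 0; 0; 0; 0; n])) rn 0) //.
by rewrite iterE upd_env.
Qed.

(* c1 and c2 encode the fixed part of the target, p0 the initial program counter *)
Definition init_loop c1 c2 p0 : loop 13 :=
  move rz [:: ru; ry; ry] ;; move ru [:: rz] ;; pair_loop 0 ;; pair_loop c1 ;; pair_loop c2 ;;
  incs [:: ry] ;; move ry [:: rn] ;; incs (nseq p0 rN) ;; power_loop.

Lemma wf_init_loop c1 c2 p0 : wf (init_loop c1 c2 p0).
Proof. by rewrite /= !wf_incs. Qed.

Lemma init_loopE c1 c2 p0 z :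
  ev (init_loop c1 c2 p0) (env [:: z]) =
  env [:: z; p0 * 2 ^ (npair (npair (npair z.*2 0) c1) c2).+1].
Proof.
rewrite (_ : ev _ _ = ev power_loop (ev (incs (nseq p0 rN)) (ev (move ry [:: rn]) (ev (incs [:: ry])
  (ev (pair_loop c2) (ev (pair_loop c1) (ev (pair_loop 0) (ev (move ru [:: rz])
  (ev (move rz [:: ru; ry; ry]) (env [:: z])))))))))) //.
rewrite !move_env ?size_mkseq //.
rewrite (_ : env (move_at _ _ _) = env [:: z; 0; 0; 0; 0; 0; 0; 0; z.*2; 0; 0; 0; 0; 0]); last first.
  by list_eq.
rewrite !pair_loopE incs_env // move_env ?size_mkseq // incs_env ?size_mkseq //.
set k := npair _ c2.
rewrite (_ : env (add_at _ _ _) = env [:: z; p0; 0; 0; 0; 0; 0; 0; 0; 0; 0; 0; 0; k.+1]); last first.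
  by rewrite /add_at /move_at /mkseq /= !occ_nseq; list_eq.
by rewrite power_loopE; apply: (env_pad 12 [:: _; _]).
Qed.

(** * Decoding and applying the rules *)

Definition pop_tail : loop 13 := tri_loop ;; incs [:: ry].

Local Notation "c ;;; d" := (Seq c d) (at level 62, right associativity).

(** The pairs of sum [m] fill the interval between two consecutive triangular numbers. These
    intervals are disjoint, so the code determines the sum, and then the offset. *)
Lemma npair_inj a b c d : npair a b = npair c d -> a = c /\ b = d.
Proof.
have tri_mono m k : m <= k -> (m * m.+1)./2 <= (k * k.+1)./2.
  by move=> mk; apply: half_leq; apply: leq_mul.
have lt m k e f : e <= m -> m < k -> (m * m.+1)./2 + e < (k * k.+1)./2 + f.
  by move=> em /tri_mono; rewrite tri_S; lia.
rewrite /npair => E; suff abcd : a + b = c + d by rewrite abcd in E; lia.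
case: (ltngtP (a + b) (c + d)) => // H.
  by have := lt _ _ b d (leq_addl _ _) H; rewrite E ltnn.
by have := lt _ _ d b (leq_addl _ _) H; rewrite E ltnn.
Qed.

Lemma sem_seqP K (c d : cmd K) s s' : sem (Seq c d) s s' <-> exists2 u, sem c s u & sem d u s'.
Proof. by []. Qed.

(* guesses the head (in x) and the tail (in t) of the list coded by w *)
Definition pop : cmd 14 :=
  Star (compile (incs [:: rx; ru])) ;;; Star (compile (incs [:: rt; ru; ry])) ;;;
  compile pop_tail ;;; equalize ry rw ;;; compile (move rt [:: rw]).

Lemma popP z N w a r b s s' :
  sem pop (env [:: z; N; w; a; r; b; s; 0; 0; 0; 0; 0; 0; 0]) s' <->
  exists h t, w = (npair h t).+1 /\ s' = env [:: z; N; t; a; r; b; s; h; 0; 0; 0; 0; 0; 0].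
Proof.
(* What follows the two guesses is deterministic up to the test: it recomputes the code from [h] and
   [t] and compares it with [w]. *)
have main h t s1 : sem (compile pop_tail ;;; equalize ry rw ;;; compile (move rt [:: rw]))
    (env [:: z; N; w; a; r; b; s; h; t; t; h + t; 0; 0; 0]) s1 <->
    w = (npair h t).+1 /\ s1 = env [:: z; N; t; a; r; b; s; h; 0; 0; 0; 0; 0; 0].
  rewrite sem_seq_compile //.
  rewrite (_ : ev pop_tail _ = ev (incs [:: ry]) (ev tri_loop
    (env [:: z; N; w; a; r; b; s; h; t; t; h + t; 0; 0; 0]))) //.
  rewrite tri_loopE incs_env //.
  rewrite (_ : env (add_at _ _ _) = env [:: z; N; w; a; r; b; s; h; (npair h t).+1; t; 0; 0; 0; 0]);
    last by rewrite /npair; list_eq.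
  have mvE : ev (move rt [:: rw]) (env [:: z; N; 0; a; r; b; s; h; 0; t; 0; 0; 0; 0]) =
    env [:: z; N; t; a; r; b; s; h; 0; 0; 0; 0; 0; 0] by rewrite move_env //; list_eq.
  split=> [/sem_seqP[u H1 H2]|[wE ->]].
    have [wE uE] := (equalizeP _ _ (isT : ry != rw)).1 H1.
    by move/compileP: H2 => ->; rewrite // uE !upd_env -mvE; split.
  apply/sem_seqP; exists (env [:: z; N; 0; a; r; b; s; h; 0; t; 0; 0; 0; 0]); last by apply/compileP.
  by apply/(equalizeP _ _ (isT : ry != rw)); rewrite !upd_env wE.
split=> [/sem_seqP[u /star_env [//|h ->] /sem_seqP[u' /star_env [|t ->]]]|[h [t [wE ->]]]].
- by rewrite size_mkseq.
- rewrite (_ : env (add_at _ _ _) = env [:: z; N; w; a; r; b; s; h; t; t; h + t; 0; 0; 0]).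
    by move/main=> H; exists h, t.
  by list_eq.
apply/sem_seqP; exists (env [:: z; N; w; a; r; b; s; h; 0; 0; h; 0; 0; 0]).
  by apply/star_env => //; exists h; list_eq.
apply/sem_seqP; exists (env [:: z; N; w; a; r; b; s; h; t; t; h + t; 0; 0; 0]); last by apply/main.
by apply/star_env => //; exists t; list_eq.
Qed.

Definition pop_to (v : 'I_14) : cmd 14 := pop ;;; compile (move rx [:: v]).

Lemma pop_toP (v : 'I_14) z N w a r b s s' : v != rx ->
  sem (pop_to v) (env [:: z; N; w; a; r; b; s; 0; 0; 0; 0; 0; 0; 0]) s' <->
  exists h t, w = (npair h t).+1 /\
    s' = env (move_at rx [:: v] [:: z; N; t; a; r; b; s; h; 0; 0; 0; 0; 0; 0]).
Proof.
move=> vx; have wfm : wf (move rx [:: v]) by rewrite /= andbT orbF eq_sym.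
split=> [/sem_seqP[u /popP[h [t [wE ->]]] /compileP ->]|[h [t [wE ->]]]] //.
  by exists h, t; rewrite move_env.
apply/sem_seqP; exists (env [:: z; N; t; a; r; b; s; h; 0; 0; 0; 0; 0; 0]); first by apply/popP; exists h, t.
by apply/compileP; rewrite ?move_env.
Qed.

Definition code4 a r b s t :=
  (npair a (npair r (npair b (npair s t).+1).+1).+1).+1.

Definition read_rule : cmd 14 := pop_to ra ;;; pop_to rr ;;; pop_to rb ;;; pop_to rs.

Lemma read_ruleP z N w s' :
  sem read_rule (env [:: z; N; w; 0; 0; 0; 0; 0; 0; 0; 0; 0; 0; 0]) s' <->
  exists a r b s t, w = code4 a r b s t /\
    s' = env [:: z; N; t; a; r; b; s; 0; 0; 0; 0; 0; 0; 0].
Proof.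
have mv1 t h : env (move_at rx [:: ra] [:: z; N; t; 0; 0; 0; 0; h; 0; 0; 0; 0; 0; 0]) =
  env [:: z; N; t; h; 0; 0; 0; 0; 0; 0; 0; 0; 0; 0] by list_eq.
have mv2 a t h : env (move_at rx [:: rr] [:: z; N; t; a; 0; 0; 0; h; 0; 0; 0; 0; 0; 0]) =
  env [:: z; N; t; a; h; 0; 0; 0; 0; 0; 0; 0; 0; 0] by list_eq.
have mv3 a r t h : env (move_at rx [:: rb] [:: z; N; t; a; r; 0; 0; h; 0; 0; 0; 0; 0; 0]) =
  env [:: z; N; t; a; r; h; 0; 0; 0; 0; 0; 0; 0; 0] by list_eq.
have mv4 a r b t h : env (move_at rx [:: rs] [:: z; N; t; a; r; b; 0; h; 0; 0; 0; 0; 0; 0]) =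
  env [:: z; N; t; a; r; b; h; 0; 0; 0; 0; 0; 0; 0] by list_eq.
split=> [/sem_seqP[u1 /pop_toP[//|a [t1 [-> ->]]]]|[a [r [b [s [t [-> ->]]]]]]].
  rewrite mv1 => /sem_seqP[u2 /pop_toP[//|r [t2 [-> ->]]]].
  rewrite mv2 => /sem_seqP[u3 /pop_toP[//|b [t3 [-> ->]]]].
  rewrite mv3 => /pop_toP[//|s [t4 [-> ->]]].
  by rewrite mv4; exists a, r, b, s, t4.
apply/sem_seqP; eexists; first by apply/pop_toP => //; exists a; eexists.
rewrite mv1; apply/sem_seqP; eexists; first by apply/pop_toP => //; exists r; eexists.
rewrite mv2; apply/sem_seqP; eexists; first by apply/pop_toP => //; exists b; eexists.
by rewrite mv3; apply/pop_toP => //; exists s, t; rewrite mv4.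
Qed.

Definition skip_rule : cmd 14 :=
  read_rule ;;; compile (move ra [::] ;; move rr [::] ;; move rb [::] ;; move rs [::]).

Lemma skip_ruleP z N w s' :
  sem skip_rule (env [:: z; N; w; 0; 0; 0; 0; 0; 0; 0; 0; 0; 0; 0]) s' <->
  exists2 t, exists a r b s, w = code4 a r b s t &
    s' = env [:: z; N; t; 0; 0; 0; 0; 0; 0; 0; 0; 0; 0; 0].
Proof.
have clE t a r b s :
    ev (move ra [::] ;; move rr [::] ;; move rb [::] ;; move rs [::])
       (env [:: z; N; t; a; r; b; s; 0; 0; 0; 0; 0; 0; 0]) =
    env [:: z; N; t; 0; 0; 0; 0; 0; 0; 0; 0; 0; 0; 0].
  rewrite (_ : ev _ _ = ev (move rs [::]) (ev (move rb [::]) (ev (move rr [::]) (ev (move ra [::])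
    (env [:: z; N; t; a; r; b; s; 0; 0; 0; 0; 0; 0; 0]))))) //.
  by rewrite !move_env ?size_mkseq //; list_eq.
split=> [/sem_seqP[u /read_ruleP[a [r [b [s [t [-> ->]]]]]] /compileP ->]|[t [a [r [b [s ->]]]] ->]] //.
  by rewrite clE; exists t => //; exists a, r, b, s.
apply/sem_seqP; exists (env [:: z; N; t; a; r; b; s; 0; 0; 0; 0; 0; 0; 0]).
  by apply/read_ruleP; exists a, r, b, s, t.
by apply/compileP; rewrite ?clE.
Qed.

Definition flat_rules (l : seq rule) : seq nat :=
  flatten [seq [:: q.1.1.1; q.1.1.2; q.1.2; q.2] | q <- l].

Lemma list_code_flat a r b s l :
  list_code (flat_rules ((a, r, b, s) :: l)) = code4 a r b s (list_code (flat_rules l)).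
Proof. by []. Qed.

Lemma code4_inj a r b s t a' r' b' s' t' : code4 a r b s t = code4 a' r' b' s' t' ->
  [/\ (a, r, b, s) = (a', r', b', s') & t = t'].
Proof.
by case=> /npair_inj[-> [/npair_inj[-> [/npair_inj[-> [/npair_inj[-> ->]]]]]]].
Qed.

Definition pops w t := exists a r b s, w = code4 a r b s t.

(** Skipping an arbitrary number of rules and reading the next one is a nondeterministic choice from
    the list. *)
Lemma pops_rules a r b s l :
  (exists w t, rtc pops (list_code (flat_rules l)) w /\ w = code4 a r b s t) <-> (a, r, b, s) \in l.
Proof.
split=> [[w [t [run wE]]]|].
  move cE : (list_code _) run => c run; elim: run l cE wE => [{}w|{}w w1 w2 pw _ IH].
    case=> [|[[[a' r'] b'] s'] l] <- //; rewrite list_code_flat => /code4_inj[<- _].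
    by rewrite inE eqxx.
  case: pw => a' [r' [b' [s' ->]]] [|[[[a1 r1] b1] s1] l] //.
  by rewrite list_code_flat => /code4_inj[_ /IH H] /H; rewrite inE orbC => ->.
elim: l => // -[[[a1 r1] b1] s1] l IH; rewrite inE => /predU1P[[-> -> -> ->]|/IH[w [t [run wE]]]].
  exists (code4 a1 r1 b1 s1 (list_code (flat_rules l))), (list_code (flat_rules l)).
  by split=> //; apply: rtc_refl.
exists w, t; split=> //; rewrite list_code_flat; apply: rtc_step run.
by exists a1, r1, b1, s1.
Qed.

(** One round adds [a] to [rx] and [b] to [ry], restoring both through [ru]; iterated under [Star],
    it guesses the [M] of an affine rule. *)
Definition add_loop : loop 13 :=
  move ra [:: rx; ru] ;; move ru [:: ra] ;; move rb [:: ry; ru] ;; move ru [:: rb].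

Lemma star_addP z N w a r b s s' :
  sem (Star (compile add_loop)) (env [:: z; N; w; a; r; b; s; 0; 0; 0; 0; 0; 0; 0]) s' <->
  exists m, s' = env [:: z; N; w; a; r; b; s; a * m; b * m; 0; 0; 0; 0; 0].
Proof.
pose f m := env [:: z; N; w; a; r; b; s; a * m; b * m; 0; 0; 0; 0; 0].
have addE m : ev add_loop (f m) = f m.+1.
  rewrite (_ : ev _ _ = ev (move ru [:: rb]) (ev (move rb [:: ry; ru])
    (ev (move ru [:: ra]) (ev (move ra [:: rx; ru]) (f m))))) //.
  by rewrite !move_env ?size_mkseq //; rewrite /f !mulnS; list_eq.
have f0 : env [:: z; N; w; a; r; b; s; 0; 0; 0; 0; 0; 0; 0] = f 0 by rewrite /f !muln0.
have step_f m t : sem (compile add_loop) (f m) t <-> exists2 k, m.+1 = k & t = f k.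
  rewrite compileP //; split=> [->|[k <- ->]]; last by rewrite addE.
  by exists m.+1 => //; rewrite addE.
rewrite f0; apply: iff_trans (rtc_image step_f 0 s') _.
split=> [[m _ ->]|[m ->]]; first by exists m.
exists m => //; suff : forall k, rtc (fun x y => x.+1 = y) k (k + m) by apply.
elim: m => [|m IH] k; first by rewrite addn0; apply: rtc_refl.
by apply: rtc_step (_ : k.+1 = _) _; [|rewrite -addSnnS].
Qed.

Definition apply_rule : cmd 14 :=
  Star (compile add_loop) ;;; compile (move rr [:: rx] ;; move rs [:: ry]) ;;;
  equalize rx rN ;;; compile (move ry [:: rN] ;; move ra [::] ;; move rb [::] ;; move rw [::]).

Lemma apply_ruleP z N w a r b s s' :
  sem apply_rule (env [:: z; N; w; a; r; b; s; 0; 0; 0; 0; 0; 0; 0]) s' <->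
  exists m, N = a * m + r /\ s' = env [:: z; b * m + s; 0; 0; 0; 0; 0; 0; 0; 0; 0; 0; 0; 0].
Proof.
have addE m : ev (move rr [:: rx] ;; move rs [:: ry])
    (env [:: z; N; w; a; r; b; s; a * m; b * m; 0; 0; 0; 0; 0]) =
    env [:: z; N; w; a; 0; b; 0; a * m + r; b * m + s; 0; 0; 0; 0; 0].
  rewrite (_ : ev _ _ = ev (move rs [:: ry]) (ev (move rr [:: rx])
    (env [:: z; N; w; a; r; b; s; a * m; b * m; 0; 0; 0; 0; 0]))) //.
  by rewrite !move_env ?size_mkseq //; list_eq.
have clE m : ev (move ry [:: rN] ;; move ra [::] ;; move rb [::] ;; move rw [::])
    (env [:: z; 0; w; a; 0; b; 0; 0; b * m + s; 0; 0; 0; 0; 0]) =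
    env [:: z; b * m + s; 0; 0; 0; 0; 0; 0; 0; 0; 0; 0; 0; 0].
  rewrite (_ : ev _ _ = ev (move rw [::]) (ev (move rb [::]) (ev (move ra [::]) (ev (move ry [:: rN])
    (env [:: z; 0; w; a; 0; b; 0; 0; b * m + s; 0; 0; 0; 0; 0]))))) //.
  by rewrite !move_env ?size_mkseq //; list_eq.
split=> [/sem_seqP[u /star_addP[m ->]]|[m [NE ->]]].
  rewrite sem_seq_compile // addE => /sem_seqP[u1 H1 /compileP ->] //.
  have [NE uE] := (equalizeP _ _ (isT : rx != rN)).1 H1.
  by exists m; rewrite uE !upd_env -clE.
apply/sem_seqP; eexists; first by apply/star_addP; exists m.
rewrite sem_seq_compile // addE.
apply/sem_seqP; exists (env [:: z; 0; w; a; 0; b; 0; 0; b * m + s; 0; 0; 0; 0; 0]).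
  by apply/(equalizeP _ _ (isT : rx != rN)); rewrite !upd_env NE.
by apply/compileP; rewrite ?clE.
Qed.

(** The program is copied to [rw] first, so each step chooses afresh among all rules. *)
Definition machine_step : cmd 14 :=
  compile (move rz [:: rw; ru] ;; move ru [:: rz]) ;;; Star skip_rule ;;; read_rule ;;; apply_rule.

Lemma machine_stepP l N s' :
  sem machine_step (env [:: list_code (flat_rules l); N; 0; 0; 0; 0; 0; 0; 0; 0; 0; 0; 0; 0]) s' <->
  exists2 N', rule_step l N N' &
    s' = env [:: list_code (flat_rules l); N'; 0; 0; 0; 0; 0; 0; 0; 0; 0; 0; 0; 0].
Proof.
set z := list_code _; rewrite sem_seq_compile //.
rewrite (_ : ev _ _ = ev (move ru [:: rz]) (ev (move rz [:: rw; ru])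
  (env [:: z; N; 0; 0; 0; 0; 0; 0; 0; 0; 0; 0; 0; 0]))) // !move_env ?size_mkseq //.
rewrite (_ : env (move_at _ _ _) = env [:: z; N; z; 0; 0; 0; 0; 0; 0; 0; 0; 0; 0; 0]);
  last by list_eq.
have skips := rtc_image (fun w t => skip_ruleP z N w t).
split=> [/sem_seqP[u /skips[w run ->] /sem_seqP[v /read_ruleP[a [r [b [s [t [wE ->]]]]]]]]|].
  move=> /apply_ruleP[m [NE ->]]; exists (b * m + s) => //; exists a, r, b, s, m; split=> //.
  by apply/pops_rules; exists w, t.
case=> N' [a [r [b [s [m [/pops_rules[w [t [run wE]]] NE N'E]]]]]] ->.
apply/sem_seqP; exists (env [:: z; N; w; 0; 0; 0; 0; 0; 0; 0; 0; 0; 0; 0]).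
  by apply/skips; exists w.
apply/sem_seqP; exists (env [:: z; N; t; a; r; b; s; 0; 0; 0; 0; 0; 0; 0]).
  by apply/read_ruleP; exists a, r, b, s, t.
by apply/apply_ruleP; exists m; rewrite N'E.
Qed.

Definition universal c1 c2 p0 : cmd 14 :=
  compile (init_loop c1 c2 p0) ;;; Star machine_step ;;; Zero rN.

Lemma universalP c1 c2 p0 l :
  let z := list_code (flat_rules l) in
  (exists s', sem (universal c1 c2 p0) (env [:: z]) s') <->
  rtc (rule_step l) (p0 * 2 ^ (npair (npair (npair z.*2 0) c1) c2).+1) 0.
Proof.
move=> z; have steps := rtc_image (machine_stepP l).
have initE : ev (init_loop c1 c2 p0) (env [:: z]) =
    env [:: z; p0 * 2 ^ (npair (npair (npair z.*2 0) c1) c2).+1; 0; 0; 0; 0; 0; 0; 0; 0; 0; 0; 0; 0].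
  by rewrite init_loopE; apply/esym/(env_pad 12 [:: _; _]).
split=> [[s']|run].
  rewrite sem_seq_compile ?wf_init_loop // initE => /sem_seqP[u /steps[N run ->] [NE _]].
  by rewrite -[X in rtc _ _ X]NE.
exists (env [:: z; 0; 0; 0; 0; 0; 0; 0; 0; 0; 0; 0; 0; 0]).
rewrite sem_seq_compile ?wf_init_loop // initE.
by apply/sem_seqP; exists (env [:: z; 0; 0; 0; 0; 0; 0; 0; 0; 0; 0; 0; 0; 0]); [apply/steps; exists 0|].
Qed.

(** * Undecidability *)

Lemma exec_unique p f f' s t t' : exec p f s = Some t -> exec p f' s = Some t' -> t = t'.
Proof.
elim: f f' s => // f IH [|f'] s //=; case: (step p s) => [s1|]; first exact: IH.
by move=> [<-] [].
Qed.

Lemma halts_with_unique p x y y' : halts_with p x y -> halts_with p x y' -> y = y'.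
Proof. by move=> [f [s [fs <-]]] [f' [s' [fs' <-]]]; rewrite (exec_unique fs fs'). Qed.

Section Reduction.

Variables (R : nzRingType) (code : R -> nat).

(* Both are constants of the program the tiles are built from, so they must not depend on the
   tile set: this is why labels come first in [basis]. *)
Definition mark_code := npair (index true (enum {: bool})) (code 1%R).
Definition start_code := (npair (npair (npair 0 0) (npair (index false (enum {: bool})) (code 1%R))) 0).+1.

Definition U : cmd 14 := universal mark_code start_code (pc_prime 0).

Lemma elt_code_cmd_target z : elt_code code (cmd_target R U z) =
  (npair (npair (npair z.+1.*2 0) mark_code) start_code).+1.
Proof. exact: elt_code_target. Qed.

Lemma conf_code_init B n : 0 < B -> conf_code B (init n) = pc_prime 0 * 2 ^ n.
Proof.
case: B => // B _; rewrite /conf_code /regs_code big_ord_recl /= big1 ?muln1 //.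
Qed.

(** The diagonal instance. The target encodes the rules of [p], and [U] recomputes the code of that
    target from the rules and feeds it to [p]; the self-reference thus needs no fixed-point
    theorem. *)
Lemma subset_sum_halts p : exists z, 
  subset_sum (cmd_tiles R U rz) (cmd_target R U z) <->
  halts_with p (elt_code code (cmd_target R U z)) 0.
Proof.
have [B pB] := prog_boundP p; have B0 : 0 < B by case/andP: pB => /(leq_trans _)->.
pose z := list_code (flat_rules (rules p B)).
(* As [B] is positive, the list contains the rules of position 0 and is not empty. *)
have z0 : 0 < z.
  rewrite /z /rules; case: (B) B0 => //= B' _.
  by case: (fetch p 0) => [[r|r j]|].
(* With parameter [z.-1] the start row holds [z] tokens and the mark lies at distance [z], the
   number from which [U] builds the code. *)
exists z.-1; rewrite subset_sum_cmd elt_code_cmd_target -(sim_halts _ pB) conf_code_init // prednK //.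
rewrite -universalP -/z (_ : start_env rz z.-1 = env [:: z]) //.
by apply: functional_extensionality => -[|x]; rewrite /start_env /env /= ?prednK // nth_nil.
Qed.

End Reduction.

Theorem theorem4 (R : nzRingType) (code : R -> nat) (Heff : effective code) :
  exists (k : nat) (F : seq (seq (entry R k))),
    (forall f, f \in F -> nonzero_elt f) /\
    ~ (exists p : prog, forall m : seq (entry R k),
          answers p (elt_code code m) (subset_sum F m)).
Proof.
exists _, (cmd_tiles R (U code) rz); split=> [|[p Hp]]; first exact: cmd_tiles_nonzero.
have [z Hz] := subset_sum_halts code p.
(* If [p] answers 1, the target is a subset sum, so [p] also halts with 0. If it answers 0, that
   very halting makes the target a subset sum. *)
case: (Hp (cmd_target R (U code) z)) => [[/Hz h0 h1]|[N /Hz //]].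
by have := halts_with_unique h0 h1.
Qed.
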